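(* Let $g=(g_1,\ldots,g_m)\in\mathcal V_r^m$, let $K=\{(x,\lambda)\in\mathbb R^n\times\mathbb R^r:g_i(x,\lambda)\ge0,\ i=1,\ldots,m\}$, and suppose that $\mathcal M_x(g)$ is restricted Archimedean. A linear functional $\mathcal L:\mathcal V_r\to\mathbb R$ satisfies $$\mathcal L(1)=1,\qquad \mathcal L(\mathcal M_x(g))\subseteq[0,\infty)$$ if and only if there exist a compactly supported Borel probability measure $\mu$ on $\mathbb R^n$ and a bounded Borel map $\tau:\operatorname{supp}\mu\to\mathbb R^r$ such that $$(x,\tau(x))\in K\ \text{ for }\mu\text{-almost every }x,\qquad \mathcal L(p)=\int p(x,\tau(x))\,d\mu(x)\quad\text{for all }p\in\mathcal V_r.$$ Moreover, the measure $\mu$ is uniquely determined by $\mathcal L$, and each component of $\tau$ is determined by $\mathcal L$ $\mu$-almost everywhere.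
   Context: Here $x=(x_1,\ldots,x_n)$, $\lambda=(\lambda_1,\ldots,\lambda_r)$. $\mathcal V_r=\{p_0(x)+\sum_{k=1}^r\lambda_k p_k(x): p_0,\ldots,p_r\in\mathbb R[x]\}$ is the real vector space of polynomials affine in $\lambda$. $\Sigma[x]$ is the cone of finite sums of squares in $\mathbb R[x]$. $\mathcal M_x(g)=\{\sigma_0+\sum_{i=1}^m\sigma_i g_i:\sigma_0,\ldots,\sigma_m\in\Sigma[x]\}$. It is restricted Archimedean if for every $p\in\mathcal V_r$ there is $N>0$ such that $N+p,\ N-p\in\mathcal M_x(g)$. *)

(* Defs.v *)
From HB Require Import structures.
From mathcomp Require Import all_boot all_order all_algebra.
From mathcomp Require Import all_classical all_reals all_analysis.
(* The notations of mpoly clash with those of MathComp-Analysis. *)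
From mathcomp Require Import -(notations) mpoly.

Set Implicit Arguments.
Unset Strict Implicit.
Unset Printing Implicit Defensive.

Import Order.TTheory GRing.Theory Num.Theory.
Import numFieldNormedType.Exports.

Local Open Scope classical_set_scope.
Local Open Scope ring_scope.

(* A polynomial p_0(x) + \sum_k lambda_k p_k(x), with x of size n and lambda of
   size r, is given by its coefficients: p.1 is p_0 and p.2 k is p_k. These are
   uniquely determined by the polynomial ([Vr_poly_inj]), and the real vector
   space structure is the coefficientwise one of the library. *)
Notation Vr R n r := (mpoly n R * {ffun 'I_r -> mpoly n R})%type.

(* R^n with its Borel sigma-algebra; as a type it is 'rV[R]_n. *)
Notation borelRn R n := (g_sigma_algebraType (@open 'rV[R]_n)).

Section AffineInLambda.
Context {R : realType} {n r : nat}.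
Implicit Types (s : mpoly n R) (p : Vr R n r).

(* The inclusion of R[x] into V_r. *)
Definition Vr_of_polyx s : Vr R n r := (s, 0).

Definition Vr_mulx s p : Vr R n r := (s * p.1, [ffun k => s * p.2 k]).

Definition evalx s (x : 'rV[R]_n) : R := meval (x ord0) s.

Definition Vr_eval p (x : 'rV[R]_n) (l : 'rV[R]_r) : R :=
  evalx p.1 x + \sum_(k < r) l ord0 k * evalx (p.2 k) x.

(* The element of R[x][lambda] with coefficients p; the statement does not use
   it, the four lemmas below check the encoding against it. *)
Definition Vr_poly p : mpoly r (mpoly n R) :=
  mpolyC r p.1 + \sum_(k < r) p.2 k *: mpolyX (mpoly n R) (mnm1 k).

Lemma Vr_poly_inj : injective Vr_poly.
Proof.
have c0 p : mcoeff mnm0 (Vr_poly p) = p.1.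
  rewrite /Vr_poly mcoeffD mcoeffC eqxx mulr1 raddf_sum big1 ?addr0 //= => k _.
  by rewrite mcoeffZ mcoeffX mnm1_eq0 mulr0.
have ck p k : mcoeff (mnm1 k) (Vr_poly p) = p.2 k.
  rewrite /Vr_poly mcoeffD mcoeffC mnm1_eq0 mulr0 add0r raddf_sum /=.
  rewrite (bigD1 k) //= mcoeffZ mcoeffX eqxx mulr1 big1 ?addr0 // => j jk.
  rewrite mcoeffZ mcoeffX; case: eqP => [/mnmP/(_ k)|]; last by rewrite mulr0.
  by rewrite !mnm1E eqxx (negPf jk).
move=> [p0 p] [q0 q] pq; congr (_, _).
  by rewrite -[p0](c0 (p0, p)) pq c0.
by apply/ffunP => k; rewrite -[LHS](ck (p0, p)) pq ck.
Qed.

Lemma Vr_polyD p q : Vr_poly (p + q) = Vr_poly p + Vr_poly q.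
Proof.
rewrite /Vr_poly /= mpolyCD addrACA; congr (_ + _).
by rewrite -big_split; apply: eq_bigr => k _; rewrite ffunE scalerDl.
Qed.

Lemma Vr_poly_mulx s p : Vr_poly (Vr_mulx s p) = mpolyC r s * Vr_poly p.
Proof.
rewrite /Vr_poly /= mulrDr -mpolyCM mulr_sumr; congr (_ + _).
by apply: eq_bigr => k _; rewrite ffunE mul_mpolyC scalerA.
Qed.

Lemma Vr_eval_poly p x l :
  Vr_eval p x l = evalx (meval (fun k => mpolyC n (l ord0 k)) (Vr_poly p)) x.
Proof.
rewrite /Vr_eval /evalx /Vr_poly mevalD mevalC raddf_sum mevalD raddf_sum /=.
congr (_ + _); apply: eq_bigr => k _.
by rewrite mevalZ mevalXU mevalM mevalC mulrC.
Qed.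

End AffineInLambda.

Section QuadraticModule.
Context {R : realType} {n r m : nat}.
Implicit Types g : 'I_m -> Vr R n r.

Definition sos : set (mpoly n R) :=
  [set s | exists qs : seq (mpoly n R), s = \sum_(q <- qs) q ^+ 2].

Definition quad_module g : set (Vr R n r) :=
  [set p | exists s0 (s : 'I_m -> mpoly n R),
    [/\ sos s0, forall i, sos (s i) &
        p = Vr_of_polyx s0 + \sum_(i < m) Vr_mulx (s i) (g i)]].

Definition restricted_archimedean g : Prop :=
  forall p : Vr R n r, exists N : R, [/\ 0 < N,
    quad_module g (Vr_of_polyx (mpolyC n N) + p) &
    quad_module g (Vr_of_polyx (mpolyC n N) - p)].

Definition nonneg_set g : set ('rV[R]_n * 'rV[R]_r) :=
  [set xl | forall i, 0 <= Vr_eval (g i) xl.1 xl.2].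

End QuadraticModule.

Section Representation.
Context {R : realType} {n r m : nat}.

Definition msupport (mu : set (borelRn R n) -> \bar R) : set (borelRn R n) :=
  [set x | forall U : set 'rV[R]_n, open U -> U x -> (0 < mu U)%E].

(* The map tau is given on all of R^n, but only its values on the support of mu
   matter here. *)
Definition represents (g : 'I_m -> Vr R n r) (L : Vr R n r -> R)
    (mu : probability (borelRn R n) R) (tau : borelRn R n -> borelRn R r) :
    Prop :=
  [/\ compact (msupport mu : set 'rV[R]_n),
      measurable_fun (msupport mu) tau,
      bounded_set (tau @` msupport mu : set 'rV[R]_r),
      {ae mu, forall x, msupport mu x -> nonneg_set g (x, tau x)} &
      forall p : Vr R n r,
        (L p)%:E = (\int[mu]_(x in msupport mu) (Vr_eval p x (tau x))%:E)%E].

End Representation.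

(* Main.v *)
Require Import Defs.
From HB Require Import structures.
From mathcomp Require Import all_boot all_order all_algebra.
From mathcomp Require Import all_classical all_reals all_analysis.
From mathcomp Require Import measurable_realfun.
From mathcomp Require Import -(notations) mpoly.
From mathcomp Require Import ring lra.

(* A functional L that is nonnegative on M_x(g) makes h |-> L (q^2 h)
   nonnegative for all h in M_x(g) and q in R[x].  Fix b with b^2 - x_i^2 in
   M_x(g) for all i.  Cauchy-Schwarz for the moments L (q^2 x_i^k h) shows that
   multiplication of h by b - x_i or b + x_i preserves this nonnegativity, and a
   Bernstein approximation on the box [-b, b]^n then gives L (f h) >= 0 for all
   f in R[x] that are nonnegative on the box.  For h = 1, Daniell's outer measure
     inf {sum_k L (f_k) | f_k >= 0 on the box, sum_k f_k >= 1 on A}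
   is thus a Borel probability measure mu with int f dmu = L f on R[x].  If
   N + lambda_k and N - lambda_k are in M_x(g), the measure obtained in the same
   way from h = N + lambda_k is at most 2 N mu; it has a bounded density, and
   tau_k is this density minus N.  Since int f g_i(x, tau(x)) dmu = L (f g_i) >= 0
   for all f >= 0 on the box, and such f are dense in the nonnegative part of
   L^1(mu), g_i(x, tau(x)) >= 0 almost everywhere.  Conversely, a measure on the
   box with the moments of L is at most the outer measure and has the same mass,
   hence mu is unique; the density of polynomials in L^1(mu) gives the uniqueness
   of tau. *)

Set Implicit Arguments.
Unset Strict Implicit.
Unset Printing Implicit Defensive.

Import Order.TTheory GRing.Theory Num.Theory.
Import numFieldNormedType.Exports.

Local Open Scope classical_set_scope.
Local Open Scope ring_scope.

(** * Positivity on a box *)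

(** Products of the [g i] leave V_r in general, so no Positivstellensatz in all variables is
    available: what can be multiplied is a polynomial in x alone. The point is therefore to put b -
    x_i and b + x_i into a set of multipliers of functionals, which is closed under products,
    instead of into M_x(g), which need not be. Positivity of f at the points of the box cannot be
    used directly in an abstract preordering T. It is used at finitely many grid points only, and
    continuity is replaced by elements f - f(y) + eps + K |x - y|^2 of T, with K uniform in y. The
    Bernstein weights lie in T, and their variance is a polynomial identity. The functionals
    obtained in this way live on polynomials, which are not a lattice: minima and truncations are
    missing, so that the Caratheodory condition for a ball is the delicate point of the Daniell
    construction. It is verified on an approximate partition of unity by polynomials, obtained from
    the same Bernstein operator applied to Lipschitz functions. Density in L^1 is never formulated
    as such; near-optimal covers are used in its place. *)

Section ProductWeights.
Context {A : comNzRingType} {J : finType} (P : J -> bool -> A).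

(** The joint law of independent coins, taken formally: the probabilities lie in a commutative ring,
    so that a bias may be a polynomial in x and moments become polynomial identities. *)
Definition pweight (e : {ffun J -> bool}) : A := \prod_c P c (e c).

Lemma sum_pweight_prod (Q : J -> bool -> A) :
  \sum_e pweight e * \prod_c Q c (e c) = \prod_c \sum_s P c s * Q c s.
Proof.
by rewrite bigA_distr_bigA; apply: eq_bigr => e _; rewrite /pweight -big_split.
Qed.

Hypothesis P1 : forall c, \sum_s P c s = 1.

Lemma sum_pweight : \sum_e pweight e = 1.
Proof.
rewrite /pweight -bigA_distr_bigA big1 // => c _; exact: P1.
Qed.

(** Independent centered variables: each cross term of the squared sum factors through the mean of
    one of them, which is 0. *)
Lemma pweight_variance (F : J -> bool -> A) :
  (forall c, \sum_s P c s * F c s = 0) ->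
  \sum_e pweight e * (\sum_c F c (e c)) ^+ 2 =
  \sum_c \sum_s P c s * F c s ^+ 2.
Proof.
move=> F0.
under eq_bigr => e _.
  rewrite expr2 mulr_suml mulr_sumr.
  under eq_bigr => a _ do rewrite !mulr_sumr.
  over.
rewrite exchange_big; apply: eq_bigr => a _ /=.
rewrite exchange_big (bigD1 a) //= [X in _ + X]big1 ?addr0 => [|a' a'a].
  transitivity (\sum_e pweight e *
      \prod_c (if c == a then F c (e c) ^+ 2 else 1)).
    by apply: eq_bigr => e _; rewrite (bigD1 a) //= eqxx big1 ?mulr1 ?expr2 //
      => c /negPf->.
  rewrite (sum_pweight_prod (fun c s => if c == a then F c s ^+ 2 else 1)).
  rewrite (bigD1 a) //= eqxx [X in _ * X]big1 ?mulr1 // => c /negPf->.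
  by under eq_bigr do rewrite mulr1; exact: P1.
transitivity (\sum_e pweight e *
    \prod_c (if c == a then F c (e c) else if c == a' then F c (e c) else 1)).
  apply: eq_bigr => e _; rewrite (bigD1 a) //= eqxx (bigD1 a') //=.
  by rewrite (negPf a'a) eqxx big1 ?mulr1 // => c /andP[/negPf-> /negPf->].
rewrite (sum_pweight_prod (fun c s =>
  if c == a then F c s else if c == a' then F c s else 1)).
by rewrite (bigD1 a) //= eqxx F0 mul0r.
Qed.

End ProductWeights.

Lemma mpoly_ring_ind (R : nzRingType) n (P : mpoly n R -> Prop) :
  (forall c, P (mpolyC n c)) -> (forall i, P (mpolyX R (mnm1 i))) ->
  (forall p q, P p -> P q -> P (p + q)) ->
  (forall p q, P p -> P q -> P (p * q)) -> forall p, P p.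
Proof.
move=> PC PX PD PM; elim/mpolyind => [|c m p _ _ Pp].
  by rewrite -(mpolyC0 n R).
apply: (PD) => //; rewrite -mul_mpolyC; apply: (PM) => //.
rewrite mpolyXE_id; apply: big_ind => [|//|i _].
  by rewrite -(mpolyC1 n R).
elim: (m i) => [|k Pk]; first by rewrite expr0 -(mpolyC1 n R).
by rewrite exprS; exact: PM.
Qed.

Section Evalx.
Context {R : realType} {n : nat}.
Implicit Types (p q : mpoly n R) (x : 'rV[R]_n).

Lemma evalxD p q x : evalx (p + q) x = evalx p x + evalx q x.
Proof. exact: mevalD. Qed.

Lemma evalxN p x : evalx (- p) x = - evalx p x.
Proof. exact: mevalN. Qed.

Lemma evalxB p q x : evalx (p - q) x = evalx p x - evalx q x.
Proof. exact: mevalB. Qed.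

Lemma evalxM p q x : evalx (p * q) x = evalx p x * evalx q x.
Proof. exact: mevalM. Qed.

Lemma evalxC (c : R) x : evalx (mpolyC n c) x = c.
Proof. exact: mevalC. Qed.

Lemma evalxX (i : 'I_n) x : evalx (mpolyX R (mnm1 i)) x = x ord0 i.
Proof. exact: mevalXU. Qed.

Lemma evalx1 x : evalx 1 x = 1.
Proof. exact: meval1. Qed.

Lemma evalx0 x : evalx 0 x = 0.
Proof. exact: meval0. Qed.

Lemma evalx_sum (I : Type) (s : seq I) (P : pred I) (f : I -> mpoly n R) x :
  evalx (\sum_(i <- s | P i) f i) x = \sum_(i <- s | P i) evalx (f i) x.
Proof. exact: raddf_sum. Qed.

End Evalx.

Section BoxPositivstellensatz.
Context {R : realType} {n : nat}.
Implicit Types (f p q : mpoly n R) (x y : 'rV[R]_n).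

Definition box (b : R) : set 'rV[R]_n := [set x | forall i, `|x ord0 i| <= b].

Local Notation XP i := (mpolyX R (mnm1 i) : mpoly n R).
Local Notation C := (@mpolyC n R).

Definition preordering (T : set (mpoly n R)) : Prop :=
  [/\ forall p q, T p -> T q -> T (p + q),
      forall p q, T p -> T q -> T (p * q) & forall q, T (q ^+ 2)].

Context (T : set (mpoly n R)) (b : R).
Hypotheses (T_pre : preordering T) (b_gt0 : 0 < b).
Hypothesis T_box : forall i, T (C b - XP i) /\ T (C b + XP i).

Let TD p q : T p -> T q -> T (p + q). Proof. by case: T_pre => + _ _; apply. Qed.
Let TM p q : T p -> T q -> T (p * q). Proof. by case: T_pre => _ + _; apply. Qed.
Let T2 q : T (q ^+ 2). Proof. by case: T_pre => _ _; apply. Qed.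

Let TC (c : R) : 0 <= c -> T (C c).
Proof. by move=> c0; rewrite -[c]sqr_sqrtr // rmorphXn; exact: T2. Qed.

Let Tsum (I : finType) (F : I -> mpoly n R) :
  (forall i, T (F i)) -> T (\sum_i F i).
Proof.
by move=> TF; apply: big_ind => //; rewrite -(mpolyC0 n R); exact: TC.
Qed.

Let Tprod (I : finType) (F : I -> mpoly n R) :
  (forall i, T (F i)) -> T (\prod_i F i).
Proof.
by move=> TF; apply: big_ind => //; rewrite -(mpolyC1 n R); exact: TC.
Qed.

Definition sqdist_poly y : mpoly n R := \sum_i (XP i - C (y ord0 i)) ^+ 2.

Let Tsqdist y : T (sqdist_poly y).
Proof. by apply: Tsum => i; exact: T2. Qed.

(** A certificate in T for the lower bound f(x) >= f(y) - eps - K |x - y|^2, where K must not depend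
    on the base point y. It is built along the ring operations. *)
Let near_const f := forall eps, 0 < eps -> exists2 K, 0 <= K &
  forall y, box b y -> T (f - C (evalx f y) + C eps + C K * sqdist_poly y).

Let bounded_poly f := exists2 N, 0 <= N &
  [/\ T (C N - f), T (C N + f) & forall y, box b y -> `|evalx f y| <= N].

(** The invariant of the induction on f: the certificate of a product uses bounds and certificates
    for both signs of the factors. *)
Let tame f := [/\ bounded_poly f, near_const f & near_const (- f)].

Let boundedN f : bounded_poly f -> bounded_poly (- f).
Proof.
move=> [N N0 [Nf1 Nf2 Nf]]; exists N => //; split; rewrite ?opprK // => y by_.
by rewrite evalxN normrN; exact: Nf.
Qed.

Let tameN f : tame f -> tame (- f).
Proof. by move=> [bf nf nNf]; split; rewrite ?opprK //; exact: boundedN. Qed.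

Let near_constD f p : near_const f -> near_const p -> near_const (f + p).
Proof.
move=> nf np eps e0.
have e20 : 0 < eps / 2 by rewrite divr_gt0.
have [K K0 Kf] := nf _ e20; have [M M0 Mp] := np _ e20.
exists (K + M); first exact: addr_ge0.
move=> y yb; have := TD (Kf y yb) (Mp y yb).
have -> : C eps = C (eps / 2) + C (eps / 2) by rewrite -mpolyCD -splitr.
by congr T; rewrite evalxD !mpolyCD; ring.
Qed.

Let tameD f p : tame f -> tame p -> tame (f + p).
Proof.
move=> [[N N0 [Nf1 Nf2 Nf]] nf nNf] [[M M0 [Mp1 Mp2 Mp]] np nNp]; split.
- exists (N + M); first exact: addr_ge0.
  split.
  + by have := TD Nf1 Mp1; congr T; rewrite mpolyCD; ring.
  + by have := TD Nf2 Mp2; congr T; rewrite mpolyCD; ring.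
  + move=> y yb; rewrite evalxD (le_trans (ler_normD _ _)) // lerD //.
      exact: Nf.
    exact: Mp.
- exact: near_constD.
- by rewrite opprD; exact: near_constD.
Qed.

(** Write f p - f(y) p(y) = (f - f(y)) p + f(y) (p - p(y)), and D for the squared distance. For the
    first term, the certificate of f times M + p, plus (e + K1 D) (M - p), plus M times the
    certificate of -f adds up to (f - f(y)) p + 3 M e + (2 M K1 + M K2) D. *)
Let near_constM f p : tame f -> tame p -> near_const (f * p).
Proof.
move=> [[N N0 [_ _ Nf]] nf nNf] [[M M0 [Mp1 Mp2 _]] np nNp] eps e0.
have s0 : 0 < 3 * M + N + 1 by lra.
(* The first term costs 3 M e, the second N e; a spare e keeps the denominator positive. *)
pose e := eps / (3 * M + N + 1).
have e_gt0 : 0 < e by rewrite divr_gt0.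
have [K1 K10 T1] := nf _ e_gt0; have [K2 K20 T2'] := nNf _ e_gt0.
have [K3 K30 T3] := np _ e_gt0; have [K4 K40 T4] := nNp _ e_gt0.
exists (2 * M * K1 + M * K2 + N * (K3 + K4)).
  by rewrite !addr_ge0 ?mulr_ge0 ?addr_ge0.
move=> y yb; have := Nf y yb; rewrite ler_norml => /andP[f1 f2].
have /TD := TM (T1 y yb) Mp2.
have TeD : T (C e + C K1 * sqdist_poly y).
  by apply: TD; [exact/TC/ltW | exact/TM/Tsqdist/TC].
move=> /(_ _ (TM TeD Mp1)) /TD /(_ (TM (TC M0) (T2' y yb))).
(* The coefficient f(y) has no fixed sign: it is split as h1 - h2 with h1, h2 >= 0 and h1 + h2 = N,
   and the certificates of p and -p are combined with these coefficients. The terms h2 K3 D and h1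
   K4 D added below remove the dependence of the constant on y. *)
have [h1 [h2 [h10 h20 Ef EN]]] : exists h1 h2,
    [/\ 0 <= h1, 0 <= h2, evalx f y = h1 - h2 & N = h1 + h2].
  by exists ((N + evalx f y) / 2), ((N - evalx f y) / 2); split; lra.
move=> /TD /(_ (TM (TC h10) (T3 y yb))) /TD /(_ (TM (TC h20) (T4 y yb))).
move=> /TD /(_ (TC (ltW e_gt0))).
move=> /TD /(_ (TM (TC h20) (TM (TC K30) (Tsqdist y)))).
move=> /TD /(_ (TM (TC h10) (TM (TC K40) (Tsqdist y)))).
congr T; rewrite evalxM !evalxN.
have -> : C eps = C e * C (3 * M + N + 1) by rewrite -mpolyCM divfK ?gt_eqF.
by rewrite Ef EN; ring.
Qed.

Let tameM f p : tame f -> tame p -> tame (f * p).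
Proof.
move=> tf tp; split; last 2 first.
- exact: near_constM.
- by rewrite -mulNr; exact/near_constM/tp/tameN.
have [[N N0 [Nf1 Nf2 Nf]] _ _] := tf; have [[M M0 [Mp1 Mp2 Mp]] _ _] := tp.
have half0 : 0 <= 2^-1 :> R by rewrite invr_ge0.
have C2 : C 2^-1 * 2 = 1 by rewrite -(rmorph_nat C 2) -mpolyCM mulVf ?mpolyC1.
exists (N * M); first exact: mulr_ge0.
split.
(* 2 (N M - f p) = (N - f) (M + p) + (N + f) (M - p). *)
- have := TM (TC half0) (TD (TM Nf1 Mp2) (TM Nf2 Mp1)); congr T.
  by rewrite mpolyCM; transitivity (C 2^-1 * 2 * (C N * C M - f * p));
    [ring | rewrite C2 mul1r].
- have := TM (TC half0) (TD (TM Nf1 Mp1) (TM Nf2 Mp2)); congr T.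
  by rewrite mpolyCM; transitivity (C 2^-1 * 2 * (C N * C M + f * p));
    [ring | rewrite C2 mul1r].
- by move=> y yb; rewrite evalxM normrM ler_pM // ?Nf // Mp.
Qed.

Let tameC c : tame (C c).
Proof.
split.
- exists `|c| => //; split => [||y _]; last by rewrite evalxC.
  + by rewrite -mpolyCB; apply: TC; rewrite subr_ge0 ler_norm.
  + rewrite -mpolyCD; apply: TC.
    by rewrite -[X in _ + X]opprK subr_ge0 -normrN ler_norm.
- move=> e e0; exists 0 => // y _; rewrite evalxC subrr add0r mpolyC0 mul0r addr0.
  exact/TC/ltW.
- move=> e e0; exists 0 => // y _; rewrite evalxN evalxC mpolyCN subrr add0r.
  by rewrite mpolyC0 mul0r addr0; exact/TC/ltW.
Qed.

Let tameX i : tame (XP i).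
Proof.
have near_X (s : R) : s ^+ 2 = 1 -> forall e, 0 < e -> exists2 K, 0 <= K &
    forall y, T (C s * XP i - C (s * y ord0 i) + C e + C K * sqdist_poly y).
  move=> s1 e e0; have se : Num.sqrt e != 0 by rewrite sqrtr_eq0 -ltNge.
  (* K = 1 / (4 e) completes the square: with u = 1 / (2 sqrt e) and s^2 = 1, (u (x_i - y_i) + s
     sqrt e)^2 = u^2 (x_i - y_i)^2 + s (x_i - y_i) + e. The other coordinates contribute squares. *)
  exists ((2 * Num.sqrt e)^-1 ^+ 2); first exact: sqr_ge0.
  move=> y; pose u := C (2 * Num.sqrt e)^-1.
  have := TD (T2 (u * (XP i - C (y ord0 i)) + C (s * Num.sqrt e)))
    (TM (T2 u) (Tsum (fun j => T2 (if j == i then 0 else XP j - C (y ord0 j))))).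
  congr T.
  rewrite /sqdist_poly [in LHS](bigD1 i) //= eqxx expr0n add0r.
  rewrite [in RHS](bigD1 i) //= (rmorphXn C) -/u.
  have -> : C e = C (s * Num.sqrt e) ^+ 2.
    by rewrite -(rmorphXn C) exprMn s1 mul1r sqr_sqrtr // ltW.
  have us : u * C (s * Num.sqrt e) * 2 = C s.
    rewrite -(rmorph_nat C 2) -!mpolyCM; congr C.
    by rewrite invfM; field.
  rewrite (eq_bigr (fun j => (XP j - C (y ord0 j)) ^+ 2)); last first.
    by move=> j /negPf->.
  by rewrite [C (s * y ord0 i)]mpolyCM -us; ring.
split.
- exists b; [exact: ltW | split; [exact: (T_box i).1|exact: (T_box i).2|]].
  by move=> y yb; rewrite evalxX; exact: yb.
- move=> e e0; have [K K0 TK] := near_X 1 (expr1n _ _) e e0.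
  by exists K => // y _; move: (TK y); rewrite evalxX mpolyC1 !mul1r.
- have N1 : (-1) ^+ 2 = 1 :> R by rewrite sqrrN expr1n.
  move=> e e0; have [K K0 TK] := near_X (-1) N1 e e0.
  exists K => // y _; move: (TK y).
  by rewrite evalxN evalxX mpolyCN mpolyC1 !mulN1r.
Qed.

Let tame_poly f : tame f.
Proof. exact: mpoly_ring_ind. Qed.

Section Grid.
Context (d : nat).
Hypothesis d_gt0 : (0 < d)%N.

Definition bsign (s : bool) : R := if s then 1 else -1.

(** Coin (i, j) shows +1 with probability (b + x_i) / (2 b) and -1 with probability (b - x_i) / (2
    b), so that the grid point has mean x. Averaging over all outcomes is the Bernstein operator of
    degree d in each coordinate, written without collecting equal outcomes into binomial
    coefficients. *)
Definition coin_weight (c : 'I_n * 'I_d) (s : bool) : mpoly n R :=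
  C (2 * b)^-1 * (C b + C (bsign s) * XP c.1).

Definition grid_point (e : {ffun 'I_n * 'I_d -> bool}) : 'rV[R]_n :=
  \row_i (b / d%:R * \sum_j bsign (e (i, j))).

Lemma grid_point_box e : box b (grid_point e).
Proof.
move=> i; rewrite mxE normrM gtr0_norm ?divr_gt0 ?ltr0n //.
rewrite -[leRHS](divfK (_ : d%:R != 0)) ?pnatr_eq0 -?lt0n //.
apply: ler_wpM2l; first by rewrite divr_ge0 ?ltW ?ltr0n.
rewrite (le_trans (ler_norm_sum _ _ _)) //.
rewrite (eq_bigr (fun=> 1)) ?sumr_const ?card_ord // => j _.
by rewrite /bsign; case: ifP; rewrite ?normrN normr1.
Qed.

Let u2b : C (2 * b)^-1 * 2 * C b = 1.
Proof.
rewrite -(rmorph_nat C 2) -!mpolyCM -mulrA mulVf ?mpolyC1 // mulf_neq0 ?gt_eqF //.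
Qed.

Lemma sum_coin_weight c : \sum_s coin_weight c s = 1.
Proof.
by rewrite big_bool /coin_weight /bsign /= mpolyCN mpolyC1 -[RHS]u2b; ring.
Qed.

Lemma coin_weight_T c s : T (coin_weight c s).
Proof.
apply: TM; first by apply: TC; rewrite invr_ge0 mulr_ge0 // ltW.
rewrite /bsign; case: s; rewrite ?mpolyCN mpolyC1 ?mulN1r ?mul1r.
  exact: (T_box _).2.
exact: (T_box _).1.
Qed.

Lemma grid_weight_T e : T (pweight coin_weight e).
Proof. by apply: Tprod => c; exact: coin_weight_T. Qed.

(** Variance of the grid point: a single step of coordinate i has values b and -b and mean x_i,
    hence variance b^2 - x_i^2; the average of d independent steps divides it by d. *)
Lemma sum_grid_weight_sqdist :
  \sum_e pweight coin_weight e * sqdist_poly (grid_point e) =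
  C d%:R^-1 * \sum_i (C b ^+ 2 - XP i ^+ 2).
Proof.
have dC : C d%:R^-1 * d%:R = 1.
  by rewrite -(rmorph_nat C) -mpolyCM mulVf ?mpolyC1 // pnatr_eq0 -lt0n.
have pairE (G : 'I_n * 'I_d -> mpoly n R) :
    \sum_c G c = \sum_k \sum_j G (k, j).
  by rewrite pair_bigA; apply: eq_bigr => -[].
under eq_bigr do rewrite mulr_sumr.
rewrite exchange_big mulr_sumr; apply: eq_bigr => i _ /=.
pose F (c : 'I_n * 'I_d) s : mpoly n R :=
  if c.1 == i then XP i - C (b * bsign s) else 0.
have Fsum e : XP i - C (grid_point e ord0 i) = C d%:R^-1 * \sum_c F c (e c).
  rewrite pairE (bigD1 i) //=.
  rewrite [X in C _ * (_ + X)]big1 ?addr0; last first.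
    by move=> j /negPf ji; rewrite big1 // => k _; rewrite /F /= ji.
  rewrite (eq_bigr (fun j => XP i - C (b * bsign (e (i, j))))); last first.
    by move=> j _; rewrite /F eqxx.
  rewrite sumrB sumr_const card_ord mulrBr -[XP i *+ d]mulr_natl mulrA dC mul1r.
  rewrite mxE -(raddf_sum C) -mulr_sumr -mpolyCM; congr (_ - C _).
  by rewrite mulrA [d%:R^-1 * b]mulrC.
under eq_bigr do rewrite Fsum exprMn mulrCA.
rewrite -mulr_sumr pweight_variance; [|exact: sum_coin_weight|].
- rewrite pairE (bigD1 i) //= [X in _ + X]big1 ?addr0; last first.
    move=> j /negPf ji; rewrite big1 // => k _; rewrite big1 // => s _.
    by rewrite /F /= ji expr0n mulr0.
  rewrite (eq_bigr (fun=> C b ^+ 2 - XP i ^+ 2)); last first.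
    move=> j _; rewrite big_bool /F /coin_weight /bsign /= eqxx mulr1 mulrN1.
    rewrite !mpolyCN mpolyC1 -[RHS]mul1r -[in RHS]u2b; ring.
  rewrite sumr_const card_ord -[RHS]mul1r -[in RHS]dC; ring.
- move=> [j k]; rewrite /F /=; case: eqP => [->|_]; last first.
    by rewrite big1 // => s _; rewrite mulr0.
  rewrite big_bool /coin_weight /bsign /= mulr1 mulrN1 !mpolyCN mpolyC1; ring.
Qed.

End Grid.

(** At a grid point y, the certificate plus f(y) >= 0 puts f + eps / 2 + K |x - y|^2 into T. The
    average of these over the grid is f + eps / 2 + (K / d) sum_i (b^2 - x_i^2); adding (K / d)
    sum_i x_i^2 leaves the constant K n b^2 / d, at most eps / 2 for large d. *)
Theorem box_positivstellensatz f eps :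
  (forall x, box b x -> 0 <= evalx f x) -> 0 < eps -> T (f + C eps).
Proof.
move=> f0 e0; have e20 : 0 < eps / 2 by rewrite divr_gt0.
have [_ /(_ _ e20) [K K0 TK] _] := tame_poly f.
pose d := (Num.truncn (K * (n%:R * b ^+ 2) / (eps / 2))).+1.
have dP : K * (n%:R * b ^+ 2) / d%:R <= eps / 2.
  rewrite ler_pdivrMr ?ltr0n // -ler_pdivrMl // mulrC ltW //.
  exact: truncnS_gt.
have d0 : (0 < d)%N by [].
have Tw := grid_weight_T (d := d).
have TS : T (\sum_e pweight (@coin_weight d) e *
    (f + C (eps / 2) + C K * sqdist_poly (@grid_point d e))).
  apply: Tsum => e; apply: TM => //.
  have := TD (TK _ (grid_point_box d0 e)) (TC (f0 _ (grid_point_box d0 e))).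
  by congr T; ring.
have KX : T (C (K / d%:R) * \sum_i XP i ^+ 2).
  by apply: TM; [apply: TC; rewrite divr_ge0|apply: Tsum => i; exact: T2].
have rest : 0 <= eps / 2 - K * (n%:R * b ^+ 2) / d%:R by rewrite subr_ge0.
have := TD (TD TS KX) (TC rest); congr T.
under eq_bigr do rewrite mulrDr [X in _ + X]mulrCA.
rewrite big_split /= -mulr_suml sum_pweight; last exact: sum_coin_weight.
rewrite -mulr_sumr sum_grid_weight_sqdist // sumrB sumr_const card_ord.
have -> : C eps = C (eps / 2) + C (eps / 2) by rewrite -mpolyCD -splitr.
move: (eps / 2) => h; rewrite -[_ *+ n]mulr_natr mpolyCB !mpolyCM; ring.
Qed.

End BoxPositivstellensatz.

(** * Functionals nonnegative on the quadratic module *)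

Lemma bernoulli_le (R : realDomainType) (u : R) m :
  1 <= u -> 1 + m%:R * (u - 1) <= u ^+ m.
Proof.
move=> u1; elim: m => [|m IH]; first by rewrite mul0r addr0 expr0.
rewrite exprS -natr1; have um : 1 <= u ^+ m by exact: exprn_ege1.
have : 0 <= (u - 1) * (u ^+ m - 1) by rewrite mulr_ge0 ?subr_ge0.
by nra.
Qed.

(* The even moments of a nonnegative functional grow at the rate of the square
   of the largest point of its support, and Cauchy-Schwarz propagates any excess
   of the first moment to the moments of order [2 ^ k]. *)
Lemma first_moment_le (R : realType) (a : nat -> R) (K b : R) :
  0 < b -> 0 <= a 0%N -> (forall m, a m ^+ 2 <= a 0%N * a (2 * m)%N) ->
  (forall m, a (2 * m)%N <= K * b ^+ (2 * m)) -> `|a 1%N| <= b * a 0%N.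
Proof.
move=> b0 a0 cs gr; rewrite leNgt; apply/negP => ba.
have {}a0 : 0 < a 0%N.
  rewrite lt_neqAle a0 andbT; apply/eqP => a00.
  have := cs 1%N; move: ba; rewrite -a00 mulr0 mul0r normr_gt0 => a1.
  by rewrite leNgt exprn_even_gt0 // a1.
pose v := `|a 1%N| / a 0%N.
have bv : b < v by rewrite ltr_pdivlMr.
have v0 : 0 < v by exact: lt_trans bv.
have lb k : a 0%N * v ^+ (2 ^ k) <= `|a (2 ^ k)%N|.
  elim: k => [|k IH]; first by rewrite expn0 expr1 mulrC divfK ?gt_eqF.
  apply: le_trans (ler_norm _); rewrite -(ler_pM2l a0).
  rewrite (_ : _ * (_ * _) = (a 0%N * v ^+ (2 ^ k)) ^+ 2); last first.
    by rewrite [RHS]exprMn -exprM -expnSr expr2 mulrA.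
  rewrite expnS; apply: le_trans (cs _).
  rewrite -[leRHS]real_normK ?num_real // lerXn2r ?nnegrE //.
  by rewrite mulr_ge0 ?(ltW a0) // exprn_ge0 // ltW.
pose u := v / b.
have u1 : 1 < u by rewrite ltr_pdivlMr // mul1r.
have ub k : a 0%N * u ^+ (2 * 2 ^ k) <= K.
  have b2 : 0 < b ^+ (2 * 2 ^ k) by rewrite exprn_gt0.
  rewrite -(ler_pM2r b2) -mulrA -exprMn divfK ?gt_eqF //.
  apply: le_trans (gr _); have := lb k.+1.
  rewrite expnS => /le_trans; apply; rewrite ler_norml lexx andbT.
  have := le_trans (sqr_ge0 _) (cs (2 ^ k)%N); rewrite pmulr_rge0 //.
  by move=> h; rewrite (le_trans _ h) // oppr_le0.
(* By Bernoulli, u ^ (2 * 2 ^ k) >= 2 * 2 ^ k (u - 1) >= k (u - 1), which exceeds K / a 0 for this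
   k. *)
pose k := (Num.truncn (K / a 0%N / (u - 1))).+1.
have := ub k; rewrite leNgt => /negP; apply.
have u10 : 0 < u - 1 by rewrite subr_gt0.
have : K / a 0%N / (u - 1) < k%:R by exact: truncnS_gt.
rewrite !ltr_pdivrMr // => /lt_le_trans; apply.
rewrite mulrC ler_wpM2l ?(ltW a0) //.
apply: le_trans (bernoulli_le (2 * 2 ^ k) (ltW u1)).
rewrite -[leLHS]add0r lerD // ler_wpM2r ?(ltW u10) // ler_nat.
by rewrite -expnS (leq_trans (leqnSn _)) // ltnW // ltn_expl.
Qed.

Section VrModule.
Context {R : realType} {n r : nat}.
Implicit Types (p q : mpoly n R) (h : Vr R n r).

Lemma Vr_mulxA p q h : Vr_mulx p (Vr_mulx q h) = Vr_mulx (p * q) h.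
Proof.
rewrite /Vr_mulx /= mulrA; congr (_, _).
by apply/ffunP => k; rewrite !ffunE mulrA.
Qed.

Lemma Vr_mulxDl p q h : Vr_mulx (p + q) h = Vr_mulx p h + Vr_mulx q h.
Proof.
rewrite /Vr_mulx mulrDl; congr (_, _).
by apply/ffunP => k; rewrite !ffunE mulrDl.
Qed.

Lemma Vr_mulxDr p h1 h2 : Vr_mulx p (h1 + h2) = Vr_mulx p h1 + Vr_mulx p h2.
Proof.
rewrite /Vr_mulx mulrDr; congr (_, _).
by apply/ffunP => k; rewrite !ffunE mulrDr.
Qed.

Lemma Vr_mulxNr p h : Vr_mulx p (- h) = - Vr_mulx p h.
Proof.
rewrite /Vr_mulx mulrN; congr (_, _).
by apply/ffunP => k; rewrite !ffunE mulrN.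
Qed.

Lemma Vr_mulxNl p h : Vr_mulx (- p) h = - Vr_mulx p h.
Proof.
rewrite /Vr_mulx mulNr; congr (_, _).
by apply/ffunP => k; rewrite !ffunE mulNr.
Qed.

Lemma Vr_mulxZl (c : R) p h : Vr_mulx (c *: p) h = c *: Vr_mulx p h.
Proof.
rewrite /Vr_mulx -scalerAl; congr (_, _).
by apply/ffunP => k; rewrite !ffunE -scalerAl.
Qed.

Lemma Vr_mulx1 h : Vr_mulx 1 h = h.
Proof.
rewrite /Vr_mulx mul1r [RHS]surjective_pairing; congr (_, _).
by apply/ffunP => k; rewrite !ffunE mul1r.
Qed.

Lemma Vr_mulx_polyx p q :
  Vr_mulx p (Vr_of_polyx q) = Vr_of_polyx (p * q) :> Vr R n r.
Proof.
rewrite /Vr_mulx /Vr_of_polyx /=; congr (_, _).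
by apply/ffunP => k; rewrite !ffunE mulr0.
Qed.

Lemma Vr_of_polyxD p q :
  Vr_of_polyx (p + q) = Vr_of_polyx p + Vr_of_polyx q :> Vr R n r.
Proof. by rewrite /Vr_of_polyx; congr (_, _); rewrite addr0. Qed.

Lemma Vr_of_polyxB p q :
  Vr_of_polyx (p - q) = Vr_of_polyx p - Vr_of_polyx q :> Vr R n r.
Proof. by rewrite /Vr_of_polyx; congr (_, _); rewrite subr0. Qed.

Lemma Vr_of_polyxZ (c : R) p :
  Vr_of_polyx (c *: p) = c *: Vr_of_polyx p :> Vr R n r.
Proof. by rewrite /Vr_of_polyx; congr (_, _); rewrite scaler0. Qed.

End VrModule.

Section MomentCone.
Context {R : realType} {n r m : nat}.
Context (g : 'I_m -> Vr R n r) (L : {scalar Vr R n r}).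
Implicit Types (p q f : mpoly n R) (h : Vr R n r).
Hypothesis L_ge0 : forall h, quad_module g h -> 0 <= L h.

Local Notation XP i := (mpolyX R (mnm1 i) : mpoly n R).
Local Notation C := (@mpolyC n R).

Lemma quad_module_sqr q h :
  quad_module g h -> quad_module g (Vr_mulx (q ^+ 2) h).
Proof.
have sosM s : sos s -> sos (q ^+ 2 * s).
  move=> [qs ->]; exists [seq q * a | a <- qs].
  by rewrite big_map mulr_sumr; apply: eq_bigr => a _; rewrite exprMn.
move=> [s0 [s [ss0 ss ->]]].
exists (q ^+ 2 * s0), (fun i => q ^+ 2 * s i).
split; [exact: sosM|by move=> i; exact/sosM/ss|].
rewrite Vr_mulxDr Vr_mulx_polyx; congr (_ + _).
rewrite (big_morph _ (Vr_mulxDr _) (_ : _ = 0)).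
  by apply: eq_bigr => i _; rewrite Vr_mulxA.
by rewrite /Vr_mulx mulr0; congr (_, _); apply/ffunP => k; rewrite !ffunE mulr0.
Qed.

Definition moment_cone h := forall q, 0 <= L (Vr_mulx (q ^+ 2) h).

Lemma quad_module_moment_cone h : quad_module g h -> moment_cone h.
Proof. by move=> Mh q; apply: L_ge0; exact: quad_module_sqr. Qed.

(** Quantifying over all h of the cone, instead of fixing one, makes products of multipliers act as
    compositions; squares are absorbed into [q ^+ 2]. Hence T is a preordering. *)
Let T : set (mpoly n R) :=
  [set p | forall h, moment_cone h -> moment_cone (Vr_mulx p h)].

Let T_preordering : preordering T.
Proof.
split.
- move=> p q Tp Tq h Hh a.
  by rewrite Vr_mulxDl Vr_mulxDr linearD addr_ge0 //; [exact: Tp|exact: Tq].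
- by move=> p q Tp Tq h Hh; rewrite -Vr_mulxA; apply: Tp; exact: Tq.
- by move=> q h Hh a; rewrite Vr_mulxA -exprMn; exact: Hh.
Qed.

Context (b : R).
Hypothesis b_gt0 : 0 < b.
Hypothesis g_arch : restricted_archimedean g.
Hypothesis b_box : forall i, quad_module g (Vr_of_polyx (C b ^+ 2 - XP i ^+ 2)).

Let first_moment h q i : moment_cone h ->
  `|L (Vr_mulx (q ^+ 2 * XP i) h)| <= b * L (Vr_mulx (q ^+ 2) h).
Proof.
move=> Hh.
have [a aE] : exists a, forall k, a k = L (Vr_mulx (q ^+ 2 * XP i ^+ k) h).
  by exists (fun k => L (Vr_mulx (q ^+ 2 * XP i ^+ k) h)).
have -> : L (Vr_mulx (q ^+ 2) h) = a 0%N by rewrite aE expr0 mulr1.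
rewrite -[X in q ^+ 2 * X]expr1 -aE.
(* Here h is any element of the moment cone. As N - h is in the module, L (q^2 x_i^(2k) h) <= N L
   (q^2 x_i^(2k)), and the latter grows at most like b^(2k) because b^2 - x_i^2 is in the module. *)
have [N [N0 _ MN]] := g_arch h.
apply: (@first_moment_le _ _ (N * L (Vr_of_polyx (q ^+ 2)))) => //.
- by rewrite aE expr0 mulr1; exact: Hh.
- move=> k.
  have quad (s t : R) :
      0 <= s ^+ 2 * a (2 * k)%N + 2 * (s * t) * a k + t ^+ 2 * a 0%N.
    have := Hh (q * (C s * XP i ^+ k + C t)).
    rewrite (_ : _ ^+ 2 = C (s ^+ 2) * (q ^+ 2 * XP i ^+ (2 * k)) +
        C (2 * (s * t)) * (q ^+ 2 * XP i ^+ k) +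
        C (t ^+ 2) * (q ^+ 2 * XP i ^+ 0)).
      by rewrite !Vr_mulxDl !mul_mpolyC !Vr_mulxZl !linearD !linearZ !aE.
    by rewrite expr0 mulnC exprM; ring.
  have a0 : 0 <= a 0%N by rewrite aE expr0 mulr1; exact: Hh.
  have a2 : 0 <= a (2 * k)%N by have := quad 1 0; lra.
  (* For a 0 = 0 the quadratic form is affine in t; unless a k = 0, some t gives it the value -1. *)
  have [a00|a00] := eqVneq (a 0%N) 0.
    have [->|ak0] := eqVneq (a k) 0; first by rewrite a00 mul0r expr0n.
    have [t ta] : exists t, 2 * t * a k = - (a (2 * k)%N + 1).
      by exists (- (a (2 * k)%N + 1) / (2 * a k)); field.
    by have := quad 1 t; rewrite a00 mulr0 addr0 expr1n !mul1r ta; lra.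
  have a0_gt0 : 0 < a 0%N by rewrite lt_neqAle eq_sym a00.
  rewrite -(ler_pM2l a0_gt0); have := quad (a 0%N) (- a k); lra.
- move=> k; rewrite aE; have : L (Vr_mulx ((q * XP i ^+ k) ^+ 2) h) <=
      N * L (Vr_of_polyx ((q * XP i ^+ k) ^+ 2)).
    rewrite -subr_ge0.
    have := quad_module_moment_cone MN (q * XP i ^+ k); congr (0 <= _).
    rewrite Vr_mulxDr Vr_mulxNr linearB Vr_mulx_polyx mulrC mul_mpolyC.
    by rewrite Vr_of_polyxZ linearZ.
  rewrite exprMn -exprM [(k * 2)%N]mulnC => /le_trans; apply.
  rewrite -mulrA ler_wpM2l // ?(ltW N0) //.
  pose S j := L (Vr_of_polyx (q ^+ 2 * XP i ^+ (2 * j))).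
  have SS j : S j.+1 <= b ^+ 2 * S j.
    rewrite -subr_ge0; have := quad_module_moment_cone (b_box i) (q * XP i ^+ j).
    rewrite Vr_mulx_polyx (_ : _ * _ =
        C (b ^+ 2) * (q ^+ 2 * XP i ^+ (2 * j)) - q ^+ 2 * XP i ^+ (2 * j.+1)).
      by rewrite Vr_of_polyxB mul_mpolyC Vr_of_polyxZ linearB linearZ.
    by rewrite mulnS exprD mulnC exprM; ring.
  rewrite -/(S k); elim: k => [|k IH].
    by rewrite /S muln0 !expr0 !mulr1.
  rewrite (le_trans (SS k)) // mulnS exprD mulrCA.
  by rewrite ler_wpM2l // exprn_ge0 // ltW.
Qed.

Let T_box i : T (C b - XP i) /\ T (C b + XP i).
Proof.
have bE q h : b * L (Vr_mulx (q ^+ 2) h) = L (Vr_mulx (q ^+ 2 * C b) h).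
  by rewrite [_ * C b]mulrC mul_mpolyC Vr_mulxZl linearZ.
split=> h Hh q; rewrite Vr_mulxA; have := first_moment q i Hh;
    rewrite bE ler_norml => /andP[].
- move=> _; rewrite -subr_ge0 -linearB -Vr_mulxNl -Vr_mulxDl.
  by rewrite mulrDr mulrN.
- move=> + _; rewrite lerNl -subr_ge0 opprK -linearD -Vr_mulxDl.
  by rewrite mulrDr addrC.
Qed.

Theorem moment_cone_mulx_ge0 f h : moment_cone h ->
  (forall x, box b x -> 0 <= evalx f x) -> 0 <= L (Vr_mulx f h).
Proof.
move=> Hh f0.
have fe e : 0 < e -> 0 <= L (Vr_mulx f h) + e * L h.
  move=> e0; have := box_positivstellensatz T_preordering b_gt0 T_box f0 e0.
  move=> /(_ h Hh 1); rewrite expr1n Vr_mulx1 Vr_mulxDl.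
  by rewrite -[C e]mulr1 mul_mpolyC Vr_mulxZl Vr_mulx1 linearD linearZ.
rewrite leNgt; apply/negP => Lneg.
have Lh : 0 < `|L h| + 1 by rewrite ltr_pwDr.
(* With this e, e L(h) <= - L(f h) / 2, which contradicts [fe]; the summand 1 guards against L(h) =
   0. *)
have e0 : 0 < - L (Vr_mulx f h) / (`|L h| + 1) / 2.
  by rewrite !divr_gt0 // oppr_gt0.
have := fe _ e0; rewrite leNgt => /negP; apply.
set l := L (Vr_mulx f h) in Lneg *.
have le : L h <= `|L h| + 1 by rewrite (le_trans (ler_norm _)) // lerDl.
have := ler_wpM2l (ltW e0) le.
rewrite [in X in _ <= X]mulrAC divfK ?gt_eqF //; lra.
Qed.

End MomentCone.

(** * Topology of the box and Weierstrass approximation *)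

Section Euclidean.
Context {R : realType} {n : nat}.
Implicit Types (p q : mpoly n R) (x y : 'rV[R]_n).

Lemma evalx_continuous p : continuous (evalx p).
Proof.
elim/mpoly_ring_ind: p => [c|i|p q cp cq|p q cp cq] x.
- rewrite (_ : evalx _ = cst c); first exact: cst_continuous.
  by apply/funext => y; rewrite evalxC.
- rewrite (_ : evalx _ = fun y => y ord0 i); first exact: coord_continuous.
  by apply/funext => y; rewrite evalxX.
- rewrite (_ : evalx _ = evalx p \+ evalx q).
    by apply: continuousD; [exact: cp|exact: cq].
  by apply/funext => y; rewrite evalxD.
- rewrite (_ : evalx _ = evalx p \* evalx q).
    by apply: continuousM; [exact: cp|exact: cq].
  by apply/funext => y; rewrite evalxM.
Qed.

Lemma continuous_borel_measurable (f : 'rV[R]_n -> R) :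
  continuous f -> measurable_fun [set: borelRn R n] (f : borelRn R n -> R).
Proof.
move=> cf; apply: (measurability _ (RGenOpens.measurableE R)).
move=> _ [_ [a [b ->] <-]]; rewrite setTI; apply: sub_sigma_algebra.
by move/continuousP : cf; apply; exact: interval_open.
Qed.

Lemma measurable_evalx p :
  measurable_fun [set: borelRn R n] (evalx p : borelRn R n -> R).
Proof. by apply: continuous_borel_measurable; exact: evalx_continuous. Qed.

Lemma open_borel_measurable (U : set 'rV[R]_n) :
  open U -> measurable (U : set (borelRn R n)).
Proof. by move=> oU; exact: sub_sigma_algebra. Qed.

Lemma closed_borel_measurable (U : set 'rV[R]_n) :
  closed U -> measurable (U : set (borelRn R n)).
Proof.
move=> /closed_openC /open_borel_measurable mU.
by rewrite -[U]setCK; exact: measurableC.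
Qed.

Lemma norm_coord_le x i : `|x ord0 i| <= `|x|.
Proof.
rewrite [leRHS]/Num.norm /= mx_normrE; apply/bigmax_geP; right => /=.
by exists (ord0, i).
Qed.

Lemma box_norm (b : R) x : 0 <= b -> box b x -> `|x| <= b.
Proof.
move=> b0 xb; rewrite [leLHS]/Num.norm /= mx_normrE; apply/bigmax_leP; split => //.
by move=> -[i j] _ /=; rewrite ord1.
Qed.

Lemma norm_sqr_le x : `|x| ^+ 2 <= \sum_i x ord0 i ^+ 2.
Proof.
have [->|x0] := eqVneq `|x| 0.
  by rewrite expr0n sumr_ge0 // => i _; exact: sqr_ge0.
have [[i j] /= xij] := mx_norm_neq0 x0; rewrite [`|x|]xij ord1.
rewrite real_normK ?num_real // (bigD1 j) //= lerDl sumr_ge0 // => k _.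
exact: sqr_ge0.
Qed.

Lemma box_closed (b : R) : closed (box b : set 'rV[R]_n).
Proof.
rewrite (_ : box b = \bigcap_(i in setT) ((fun x => x ord0 i) @^-1` `[- b, b])).
  apply: closed_bigI => i _; apply: closed_comp; last exact: itv_closed.
  by move=> x _; exact: coord_continuous.
apply/seteqP; split=> [x xb i _|x xb i].
  by rewrite /= in_itv /= -ler_norml; exact: xb.
by have := xb i I; rewrite /= in_itv /= -ler_norml.
Qed.

Lemma box_compact (b : R) : compact (box b : set 'rV[R]_n).
Proof.
apply: bounded_closed_compact; last exact: box_closed.
exists (Num.max 0 b); split; first exact: num_real.
move=> M; rewrite gt_max => /andP[M0 bM] x xb.
by apply: box_norm (ltW M0) _ => i; exact: le_trans (xb i) (ltW bM).
Qed.

(** The Lindelof property for a hereditary P: the balls with rational center and radius 1 / (k + 1)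
    that satisfy P cover every point near which P holds. It serves twice, with P the inclusion in an
    open set and with P negligibility. *)
Lemma lindelof_balls (P : set 'rV[R]_n -> Prop) :
  P set0 -> (forall V W, W `<=` V -> P V -> P W) ->
  exists (c : nat -> 'rV[R]_n) (e : nat -> R),
    (forall k, P (ball (c k) (e k))) /\
    forall x, (exists2 V, nbhs x V & P V) -> (\bigcup_k ball (c k) (e k)) x.
Proof.
move=> P0 PS.
pose good (i : 'rV[rat]_n * nat) : bool :=
  `[< P (ball (map_mx ratr i.1 : 'rV[R]_n) i.2.+1%:R^-1) >].
pose idx (k : nat) : option ('rV[rat]_n * nat) :=
  if unpickle k is Some i then if good i then Some i else None else None.
exists (fun k => if idx k is Some i then map_mx ratr i.1 else 0).
(* Indices that do not qualify get radius 0, that is, the empty ball. *)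
exists (fun k => if idx k is Some i then i.2.+1%:R^-1 else 0); split.
  move=> k; rewrite /idx; case: unpickle => [i|]; last first.
    apply: PS P0 => x; rewrite -ball_normE /ball_ /= => /(le_lt_trans _).
    by move=> /(_ 0 (normr_ge0 _)); rewrite ltxx.
  case: ifPn => [/asboolP//|_].
  apply: PS P0 => x; rewrite -ball_normE /ball_ /= => /(le_lt_trans _).
  by move=> /(_ 0 (normr_ge0 _)); rewrite ltxx.
move=> x [V /nbhs_ballP[e /= e0 xV] PV].
pose k := Num.truncn (e / 2)^-1.
have ke : k.+1%:R^-1 < e / 2.
  by rewrite invf_plt ?posrE ?ltr0n ?divr_gt0 //; exact: truncnS_gt.
have k0 : 0 < k.+1%:R^-1 :> R by rewrite invr_gt0 ltr0n.
have /choice[q qx] : forall i, exists q : rat, `|ratr q - x ord0 i| < k.+1%:R^-1.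
  move=> i; have : x ord0 i - k.+1%:R^-1 < x ord0 i + k.+1%:R^-1.
    by rewrite ltrBlDr -addrA ltrDl addr_gt0.
  move=> /rat_in_itvoo[q]; rewrite in_itv /= => /andP[q1 q2]; exists q.
  by rewrite ltr_distl q1.
have xq : ball (map_mx ratr (\row_i q i) : 'rV[R]_n) k.+1%:R^-1 x.
  by split => // i j; rewrite ord1 !mxE -ball_normE /ball_ /=; exact: qx.
exists (pickle (\row_i q i, k)) => //.
rewrite /idx pickleK; case: ifPn => //; apply: contraNP => _.
apply/asboolP; apply: PS PV => y /= qy; apply: xV.
rewrite [e]splitr; apply: le_ball (ltW (ltrD ke ke)) _ _.
by apply: ball_triangle qy; exact: ball_sym.
Qed.

Lemma open_bigcup_balls (U : set 'rV[R]_n) : open U ->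
  exists (c : nat -> 'rV[R]_n) (e : nat -> R), U = \bigcup_k ball (c k) (e k).
Proof.
move=> oU; have [||c [e [PU cov]]] := @lindelof_balls (fun V => V `<=` U).
- exact: sub0set.
- by move=> V W /subset_trans WV; apply: WV.
exists c, e; apply/seteqP; split.
  by move=> x Ux; apply: cov; exists U => //; exact: open_nbhs_nbhs.
by move=> x [k _]; exact: PU.
Qed.

(** The approximating polynomial is the grid average of F. Its weights are nonnegative on the box by
    [grid_weight_T], applied to the preordering of all polynomials nonnegative there, and the error
    is controlled by the variance. *)
Lemma weierstrass_lipschitz (F : 'rV[R]_n -> R) (k b eps : R) :
  (forall x y, `|F x - F y| <= k * `|x - y|) -> 0 < b -> 0 < eps ->
  exists p, forall x, box b x -> `|F x - evalx p x| <= eps.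
Proof.
move=> Fk b0 e0.
pose T : set (mpoly n R) := [set p | forall x, box b x -> 0 <= evalx p x].
have T_pre : preordering T.
  split=> [p q Tp Tq x xb|p q Tp Tq x xb|q x xb].
  - by rewrite evalxD addr_ge0 ?Tp ?Tq.
  - by rewrite evalxM mulr_ge0 ?Tp ?Tq.
  - by rewrite expr2 evalxM -expr2 sqr_ge0.
have T_box i : T (mpolyC n b - mpolyX R (mnm1 i)) /\
    T (mpolyC n b + mpolyX R (mnm1 i)).
  by split=> x /(_ i) xb; rewrite ?evalxB ?evalxD evalxC evalxX; move: xb;
    rewrite ler_norml; lra.
(* From (eps - k u)^2 >= 0, k u <= eps / 2 + K u^2: the Lipschitz bound becomes one by the squared
   distance. *)
pose K := k ^+ 2 / (2 * eps).
have K0 : 0 <= K by rewrite divr_ge0 ?sqr_ge0 // mulr_ge0 // ltW.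
pose d := (Num.truncn (K * (n%:R * b ^+ 2) / (eps / 2))).+1.
have d0 : (0 < d)%N by [].
have dP : K * (n%:R * b ^+ 2) / d%:R <= eps / 2.
  rewrite ler_pdivrMr ?ltr0n // -ler_pdivrMl ?divr_gt0 // mulrC ltW //.
  exact: truncnS_gt.
pose w := pweight (coin_weight b (n := n) (d := d)).
pose y := @grid_point R n b d.
have wT e x : box b x -> 0 <= evalx (w e) x.
  by move: x; have := grid_weight_T T_pre b0 T_box e.
exists (\sum_e w e * mpolyC n (F (y e))) => x xb.
have w1 : \sum_e evalx (w e) x = 1.
  by rewrite -evalx_sum sum_pweight ?evalx1 // => c; exact: sum_coin_weight.
have Fpt e : `|F x - F (y e)| <= eps / 2 + K * evalx (sqdist_poly (y e)) x.
  apply: le_trans (Fk _ _) _; set u := `|x - y e|.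
  have : u ^+ 2 <= evalx (sqdist_poly (y e)) x.
    rewrite (le_trans (norm_sqr_le _)) // /sqdist_poly evalx_sum ler_sum // => i _.
    by rewrite expr2 evalxM -expr2 evalxB evalxX evalxC !mxE.
  move=> /(ler_wpM2l K0) Ku; rewrite -lerBlDl; apply: le_trans Ku.
  have e2 : 0 <= (eps - k * u) ^+ 2 / (2 * eps).
    by rewrite divr_ge0 ?sqr_ge0 // mulr_ge0 // ltW.
  rewrite -subr_ge0 (_ : _ - _ = (eps - k * u) ^+ 2 / (2 * eps)) // /K.
  by field; rewrite gt_eqF.
have -> : F x - evalx (\sum_e w e * mpolyC n (F (y e))) x =
    \sum_e evalx (w e) x * (F x - F (y e)).
  under [RHS]eq_bigr do rewrite mulrBr.
  rewrite sumrB -mulr_suml w1 mul1r evalx_sum; congr (_ - _).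
  by apply: eq_bigr => e _; rewrite evalxM evalxC.
apply: le_trans (ler_norm_sum _ _ _) _.
apply: (@le_trans _ _ (\sum_e evalx (w e) x *
    (eps / 2 + K * evalx (sqdist_poly (y e)) x))).
  by apply: ler_sum => e _; rewrite normrM ger0_norm ?wT // ler_wpM2l ?wT.
under eq_bigr do rewrite mulrDr [X in _ + X]mulrCA -evalxM.
rewrite big_split /= -mulr_suml w1 mul1r -mulr_sumr -evalx_sum.
rewrite sum_grid_weight_sqdist // evalxM evalxC evalx_sum.
rewrite [leRHS]splitr lerD2l; apply: le_trans dP.
rewrite -mulrA ler_wpM2l // mulrC ler_wpM2r ?invr_ge0 //.
rewrite -[n in n%:R]card_ord -sum1_card natr_sum mulr_suml ler_sum // => i _.
by rewrite !expr2 evalxB !evalxM evalxC evalxX mul1r lerBlDr lerDl -expr2 sqr_ge0.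
Qed.

End Euclidean.

(** * The Daniell outer measure *)

(** The enumeration is chosen before the family: in the proof of subadditivity, the same one must
    rearrange the values of the covers at every x and the values of the functional. *)
Lemma nneseries_pair (R : realType) : exists f : nat -> nat * nat,
  forall a : nat -> nat -> \bar R, (forall i j, 0 <= a i j)%E ->
  (\sum_(i <oo) \sum_(j <oo) a i j = \sum_(k <oo) a (f k).1 (f k).2)%E.
Proof.
have /card_esym/ppcard_eqP[f] := card_nat2.
exists f => a a0.
rewrite [RHS]nneseries_esumT // [LHS]nneseries_esumT; last first.
  by move=> i; apply: nneseries_ge0 => j _ _; exact: a0.
under eq_esum do rewrite nneseries_esumT //.
rewrite (esum_esum (J := fun=> [set: nat])) //.
rewrite (_ : setT `*`` _ = [set: nat * nat]).
  by rewrite (reindex_esum [set: nat] _ f).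
by apply/seteqP; split.
Qed.

Lemma max_lipschitz (R : realDomainType) (a u v : R) :
  `|Num.max a u - Num.max a v| <= `|u - v|.
Proof.
have uv := ler_norm (u - v); have vu := ler_norm (v - u); rewrite distrC in vu.
by case: (leP a u) => au; case: (leP a v) => av;
  rewrite ?subrr ?normr0 // ler_norml; apply/andP; split; lra.
Qed.

Lemma min_lipschitz (R : realDomainType) (a u v : R) :
  `|Num.min a u - Num.min a v| <= `|u - v|.
Proof.
have uv := ler_norm (u - v); have vu := ler_norm (v - u); rewrite distrC in vu.
by case: (leP a u) => au; case: (leP a v) => av;
  rewrite ?subrr ?normr0 // ler_norml; apply/andP; split; lra.
Qed.

Section ScalarMap.
Context {R : nzRingType} {V : lmodType R} (f : V -> R).
Hypothesis f_scalar : scalar f.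

Lemma scalar_mapD u v : f (u + v) = f u + f v.
Proof. by have := f_scalar 1 u v; rewrite scale1r mul1r. Qed.

Lemma scalar_map0 : f 0 = 0.
Proof. by apply: (addrI (f 0)); rewrite -scalar_mapD !addr0. Qed.

Lemma scalar_mapZ c u : f (c *: u) = c * f u.
Proof. by have := f_scalar c u 0; rewrite !addr0 scalar_map0 addr0. Qed.

End ScalarMap.

Section DaniellOuterMeasure.
Local Open Scope ereal_scope.
Context {R : realType} {n : nat} (b : R) (Lam : mpoly n R -> R).
Implicit Types (p q : mpoly n R) (x : 'rV[R]_n) (F : 'rV[R]_n -> \bar R).

Definition box_nonneg p : Prop := forall x, box b x -> (0 <= evalx p x)%R.

Definition poly_cover F (f : nat -> mpoly n R) : Prop :=
  (forall k, box_nonneg (f k)) /\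
  (forall x, box b x -> F x <= \sum_(k <oo) (evalx (f k) x)%:E).

Definition upper_integral F : \bar R :=
  ereal_inf [set \sum_(k <oo) (Lam (f k))%:E | f in poly_cover F].

Definition daniell_measure (A : set (borelRn R n)) : \bar R :=
  upper_integral (fun x => (\1_A x)%:E).

Hypothesis Lam_scalar : scalar Lam.
Hypothesis Lam_ge0 : forall p, box_nonneg p -> (0 <= Lam p)%R.

Let LamD p q : Lam (p + q)%R = (Lam p + Lam q)%R.
Proof. exact: scalar_mapD. Qed.

Let Lam0 : Lam 0%R = 0%R.
Proof. exact: scalar_map0. Qed.

Let LamZ (c : R) p : Lam (c *: p)%R = (c * Lam p)%R.
Proof. exact: scalar_mapZ. Qed.

Let LamB p q : Lam (p - q)%R = (Lam p - Lam q)%R.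
Proof. by rewrite -scaleN1r LamD LamZ mulN1r. Qed.

Let LamCM (c : R) p : Lam (mpolyC n c * p)%R = (c * Lam p)%R.
Proof. by rewrite mul_mpolyC LamZ. Qed.

Let Lam_sum (I : Type) (s : seq I) (P : pred I) (f : I -> mpoly n R) :
  Lam (\sum_(i <- s | P i) f i)%R = (\sum_(i <- s | P i) Lam (f i))%R.
Proof. by apply: big_morph. Qed.

Lemma box_nonnegM p q : box_nonneg p -> box_nonneg q -> box_nonneg (p * q)%R.
Proof. by move=> p0 q0 x xb; rewrite evalxM mulr_ge0 ?p0 ?q0. Qed.

Let Lam_fin_ge0 (f : nat -> mpoly n R) : (forall k, box_nonneg (f k)) ->
  forall k, 0 <= (Lam (f k))%:E.
Proof. by move=> f0 k; rewrite lee_fin Lam_ge0. Qed.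

Lemma upper_integral_ge0 F : 0 <= upper_integral F.
Proof.
apply: le_ereal_inf_tmp => _ [f [f0 _] <-].
by apply: nneseries_ge0 => k _ _; exact: Lam_fin_ge0.
Qed.

Lemma le_upper_integral F G : (forall x, box b x -> F x <= G x) ->
  upper_integral F <= upper_integral G.
Proof.
move=> FG; apply: ereal_inf_le_tmp => _ [f [f0 Gf] <-].
by exists f => //; split=> // x xb; rewrite (le_trans (FG x xb)) ?Gf.
Qed.

Lemma upper_integral_poly F p : box_nonneg p ->
  (forall x, box b x -> F x <= (evalx p x)%:E) -> upper_integral F <= (Lam p)%:E.
Proof.
move=> p0 Fp; pose f k : mpoly n R := if k is 0%N then p else 0%R.
have first_term (h : mpoly n R -> R) : h 0%R = 0%R -> (0 <= h p)%R ->
    \sum_(k <oo) (h (f k))%:E = (h p)%:E.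
  move=> h0 hp; rewrite (@nneseriesD1 _ _ 0%N) //=.
    by rewrite eseries0 ?adde0 // => -[|k] // _ _; rewrite h0.
  by move=> [|k] _; rewrite ?lee_fin ?h0.
apply: ereal_inf_lbound; exists f; last first.
  by apply: first_term => //; exact: Lam_ge0.
split=> [[|k] x xb|x xb]; [exact: p0| |].
  by rewrite evalx0.
rewrite (first_term (fun q => evalx q x)) ?Fp // ?p0 //.
by rewrite evalx0.
Qed.

Lemma upper_integral_sigma_subadditive F (G : nat -> 'rV[R]_n -> \bar R) :
  (forall j x, box b x -> 0 <= G j x) ->
  (forall x, box b x -> F x <= \sum_(j <oo) G j x) ->
  upper_integral F <= \sum_(j <oo) upper_integral (G j).
Proof.
move=> G0 FG; have [[i ioo]|] := pselect (exists i, upper_integral (G i) = +oo).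
  rewrite (eseries_pinfty _ _ ioo) ?leey // => j _.
  by rewrite -ltNye (lt_le_trans _ (upper_integral_ge0 _)).
rewrite -forallNE => Goo.
apply/lee_addgt0Pr => e e0.
rewrite (le_trans _ (epsilon_trick xpredT _ (ltW e0))) //; last first.
  by move=> j; exact: upper_integral_ge0.
pose P j (f : nat -> mpoly n R) := poly_cover (G j) f /\
  \sum_(k <oo) (Lam (f k))%:E <= upper_integral (G j) + (e / (2 ^ j.+1)%:R)%:E.
have /choice[f Pf] : forall j, exists f, P j f.
  move=> j.
  have ej : (0 < e / (2 ^ j.+1)%:R)%R by rewrite divr_gt0 // ltr0n expn_gt0.
  have fin : upper_integral (G j) \is a fin_num.
    by rewrite ge0_fin_numE ?upper_integral_ge0 // ltey; apply/eqP/Goo.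
  have [_ [h hc <-] /ltW hle] := lb_ereal_inf_adherent ej fin.
  by exists h.
have [c cE] := nneseries_pair R.
apply: (@le_trans _ _ (\sum_(i <oo) \sum_(j <oo) (Lam (f i j))%:E)).
  rewrite cE; last by move=> i j; apply: Lam_fin_ge0 => k; exact: (Pf i).1.1.
  apply: ereal_inf_lbound; exists (fun k => f (c k).1 (c k).2) => //.
  split=> [k|x xb]; first exact: (Pf _).1.1.
  rewrite -(cE (fun i j => (evalx (f i j) x)%:E)); last first.
    by move=> i j; rewrite lee_fin; exact: (Pf i).1.1.
  apply: le_trans (FG x xb) _; apply: lee_nneseries => [j _ _|j _].
    exact: G0.
  exact: (Pf j).1.2.
apply: lee_nneseries => [j _ _|j _]; last exact: (Pf j).2.
by apply: nneseries_ge0 => k _ _; apply: Lam_fin_ge0 => i; exact: (Pf j).1.1.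
Qed.

Lemma daniell_measure0 : daniell_measure set0 = 0.
Proof.
apply/eqP; rewrite eq_le upper_integral_ge0 andbT.
rewrite -[leRHS]/(0%R%:E) -Lam0; apply: upper_integral_poly => x xb.
  by rewrite evalx0.
by rewrite indic0 evalx0.
Qed.

Lemma le_daniell_measure A B : A `<=` B ->
  daniell_measure A <= daniell_measure B.
Proof.
move=> AB; apply: le_upper_integral => x _; rewrite lee_fin !indicE.
by have [xA|//] := boolP (x \in A); rewrite mem_set //; exact/AB/set_mem.
Qed.

Lemma daniell_measure_sigma_subadditive : sigma_subadditive daniell_measure.
Proof.
move=> A; apply: upper_integral_sigma_subadditive => [j x _|x _].
  by rewrite lee_fin indicE.
have [[j _ xA]|nA] := pselect ((\bigcup_k A k) x).
  rewrite (@nneseriesD1 _ _ j) //.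
  have -> : \1_(A j) x = 1%R :> R by rewrite indicE mem_set.
  have -> : \1_(\bigcup_k A k) x = 1%R :> R by rewrite indicE mem_set //; exists j.
  by rewrite leeDl //; apply: nneseries_ge0 => k _ _; rewrite lee_fin indicE.
rewrite indicE memNset //; apply: nneseries_ge0 => k _ _.
by rewrite lee_fin indicE.
Qed.

Let dmu : {outer_measure set (borelRn R n) -> \bar R} :=
  HB.pack daniell_measure (isOuterMeasure.Build R (borelRn R n) daniell_measure
    daniell_measure0 (fun A => upper_integral_ge0 _) le_daniell_measure
    daniell_measure_sigma_subadditive).

Hypothesis b_gt0 : (0 < b)%R.

(** The functions h j = min (1, j max (0, e - |x - c|)) increase to the indicator of the ball. With
    phi j a polynomial within dl j of h j, d j is the increment of phi and r j is 1 - phi j, both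
    raised by the approximation errors to become nonnegative. The increments telescope, and the
    geometric tolerances keep the excess of d 0 + ... + d (k - 1) + r k over 1 below 2 delta. *)
Lemma ball_polynomial_partition (c : 'rV[R]_n) (e delta : R) : (0 < delta)%R ->
  exists d r : nat -> mpoly n R,
  [/\ forall j, box_nonneg (d j), forall j, box_nonneg (r j),
      forall x, box b x -> ball c e x -> 1 <= \sum_(j <oo) (evalx (d j) x)%:E,
      forall j x, box b x -> ~ ball c e x -> (1 <= evalx (r j) x)%R &
      forall k x, box b x ->
        (\sum_(j < k) evalx (d j) x + evalx (r k) x <= 1 + 2 * delta)%R].
Proof.
move=> d0; pose dl j : R := (delta / (2 ^ j.+1)%:R)%R.
have dl0 j : (0 < dl j)%R by rewrite divr_gt0 // ltr0n expn_gt0.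
have dlS j : (dl j = 2 * dl j.+1)%R.
  rewrite /dl [in RHS]expnS natrM invfM mulrCA [(2 * _)%R]mulrA divff //.
  by rewrite mul1r.
pose h j x : R := Num.min 1%R (j%:R * Num.max 0%R (e - `|x - c|))%R.
have hlip j x y : (`|h j x - h j y| <= j%:R * `|x - y|)%R.
  apply: le_trans (min_lipschitz _ _ _) _.
  rewrite -mulrBr normrM ger0_norm ?ler0n // ler_wpM2l //.
  apply: le_trans (max_lipschitz _ _ _) _.
  rewrite opprB addrC addrA subrK distrC (le_trans (ler_dist_dist _ _)) //.
  by rewrite opprB addrA subrK.
have h_ge0 j x : (0 <= h j x)%R.
  by rewrite le_min ler01 mulr_ge0 // le_max lexx.
have h_le1 j x : (h j x <= 1)%R by rewrite ge_min lexx.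
have hS j x : (h j x <= h j.+1 x)%R.
  rewrite le_min h_le1 ge_min; apply/orP; right.
  by apply: ler_wpM2r; rewrite ?le_max ?lexx // ler_nat.
have h0 x : h 0%N x = 0%R by rewrite /h mul0r min_r.
have /choice[phi phiP] : forall j, exists p,
    forall x, box b x -> (`|h j x - evalx p x| <= dl j)%R.
  by move=> j; exact: weierstrass_lipschitz (hlip j) b_gt0 (dl0 j).
have phi_le j x : box b x ->
    (h j x - dl j <= evalx (phi j) x <= h j x + dl j)%R.
  by move=> /(phiP j); rewrite ler_distlC.
pose d j : mpoly n R := (phi j.+1 - phi j + mpolyC n (dl j + dl j.+1))%R.
pose r j : mpoly n R := (1 - phi j + mpolyC n (dl j))%R.
have dE j x : evalx (d j) x =
    (evalx (phi j.+1) x - evalx (phi j) x + (dl j + dl j.+1))%R.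
  by rewrite evalxD evalxB evalxC.
have rE j x : evalx (r j) x = (1 - evalx (phi j) x + dl j)%R.
  by rewrite evalxD evalxB evalxC evalx1.
have d_ge0 j : box_nonneg (d j).
  move=> x xb; rewrite dE; have /andP[_] := phi_le j x xb.
  by have /andP[] := phi_le j.+1 x xb; have := hS j x; lra.
have d0E : (delta = 2 * dl 0%N)%R by rewrite /dl expn1; field.
(* The corrections dl j + dl (j + 1) sum to (3 / 2) delta - 3 dl k, where dl 0 = delta / 2. *)
have sumd k x : (\sum_(j < k) evalx (d j) x =
    evalx (phi k) x - evalx (phi 0%N) x + (2 * delta - 3 * dl k - dl 0%N))%R.
  elim: k => [|k IH]; first by rewrite big_ord0 d0E; ring.
  by rewrite big_ord_recr /= IH dE (dlS k); ring.
exists d, r; split=> //.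
- move=> j x xb; rewrite rE; have /andP[_] := phi_le j x xb.
  by have := h_le1 j x; lra.
- move=> x xb; rewrite -ball_normE /ball_ /= distrC => xc.
  have ec : (0 < e - `|x - c|)%R by rewrite subr_gt0.
  pose k := (Num.truncn ((e - `|x - c|)^-1)%R).+1.
  have hk : h k x = 1%R.
    rewrite /h max_r ?(ltW ec) // min_l //.
    by rewrite -ler_pdivrMr // div1r ltW // truncnS_gt.
  apply: le_trans (nneseries_lim_ge k _); last first.
    by move=> j _ _; rewrite lee_fin; exact: d_ge0.
  rewrite sumEFin lee_fin big_mkord sumd.
  have /andP[+ _] := phi_le k x xb; have /andP[_] := phi_le 0%N x xb.
  rewrite hk h0.
  (* Here k >= 1 matters: the partial sum is at least 1 + delta - 4 dl k, and 4 dl 1 = delta. *)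
  have : (dl k <= dl 1%N)%R.
    rewrite /dl ler_pM2l // lef_pV2 ?posrE ?ltr0n ?expn_gt0 //.
    by rewrite ler_nat leq_pexp2l.
  by have := dlS 0%N; lra.
- move=> j x xb; rewrite -ball_normE /ball_ /= distrC => /negP.
  rewrite -leNgt => xc; rewrite rE; have /andP[_] := phi_le j x xb.
  by rewrite /h max_l ?subr_le0 // mulr0 min_r //; lra.
- move=> k x xb; rewrite sumd rE; have /andP[+ _] := phi_le 0%N x xb.
  by rewrite h0; have := dl0 k; lra.
Qed.

(** A cover f of A is cut by the partition: the products f k * d j cover the part of A in the ball,
    and for every J the products f k * r J cover the part outside. The first J terms inside and the
    part outside together cost at most 1 + 2 delta times the cost of f. The outer measure of the
    part outside does not depend on J, so J can tend to infinity in the inner sum alone. *)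
Lemma ball_caratheodory (c : 'rV[R]_n) (e : R) :
  daniell_measure.-caratheodory (ball c e).
Proof.
apply: (le_caratheodory_measurable (mu := dmu)) => A /=.
apply: le_ereal_inf_tmp => _ [f [f0 Af] <-].
set S := \sum_(k <oo) (Lam (f k))%:E.
have S0 : 0 <= S by apply: nneseries_ge0 => k _ _; exact: Lam_fin_ge0.
have [->|Sfin] := eqVneq S +oo; first exact: leey.
have {}Sfin : S \is a fin_num by rewrite ge0_fin_numE // ltey.
apply/lee_addgt0Pr => eps eps0.
(* Chosen so that 2 delta S <= eps, also for S = 0. *)
pose delta : R := (eps / (2 * (fine S + 1)))%R.
have S1 : (0 < 2 * (fine S + 1))%R by rewrite mulr_gt0 // ltr_wpDl // fine_ge0.
have delta0 : (0 < delta)%R by rewrite divr_gt0.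
have [d [r [d0 r0 d1 r1 dr]]] := ball_polynomial_partition c e delta0.
have Lfd0 j k : 0 <= (Lam (f k * d j)%R)%:E.
  by rewrite lee_fin; apply: Lam_ge0; exact: box_nonnegM.
have Lfr0 J k : 0 <= (Lam (f k * r J)%R)%:E.
  by rewrite lee_fin; apply: Lam_ge0; exact: box_nonnegM.
have inside : daniell_measure (A `&` ball c e) <=
    \sum_(j <oo) \sum_(k <oo) (Lam (f k * d j)%R)%:E.
  apply: (@le_trans _ _ (\sum_(j <oo)
      upper_integral (fun x => (\1_A x * evalx (d j) x)%R%:E))).
    apply: upper_integral_sigma_subadditive => [j x xb|x xb].
      by rewrite lee_fin mulr_ge0 ?d0 // indicE.
    rewrite indicE; have [/set_mem[xA xc]|_] := boolP (_ \in _); last first.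
      by apply: nneseries_ge0 => j _ _; rewrite lee_fin mulr_ge0 ?d0 // indicE.
    under eq_eseriesr do rewrite indicE mem_set // mul1r.
    exact: d1.
  apply: lee_nneseries => [j _ _|j _]; first exact: upper_integral_ge0.
  apply: ereal_inf_lbound; exists (fun k => (f k * d j)%R) => //.
  split=> [k|x xb]; first exact: box_nonnegM.
  under eq_eseriesr do rewrite evalxM EFinM muleC.
  rewrite nneseriesZl; last by move=> k _; rewrite lee_fin f0.
  rewrite EFinM muleC; apply: lee_wpmul2l; first by rewrite lee_fin d0.
  exact: Af.
have outside J : daniell_measure (A `&` ~` ball c e) <=
    \sum_(k <oo) (Lam (f k * r J)%R)%:E.
  apply: ereal_inf_lbound; exists (fun k => (f k * r J)%R) => //.
  split=> [k|x xb]; first exact: box_nonnegM.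
  rewrite indicE; have [/set_mem[xA xc]|_] := boolP (_ \in _); last first.
    by apply: nneseries_ge0 => k _ _; rewrite lee_fin; exact: box_nonnegM.
  apply: (@le_trans _ _ (\1_A x)%:E); first by rewrite indicE mem_set.
  apply: le_trans (Af x xb) _; apply: lee_nneseries => [k _ _|k _].
    by rewrite lee_fin f0.
  by rewrite lee_fin evalxM ler_peMr ?f0 // r1.
have total J : \sum_(j < J) \sum_(k <oo) (Lam (f k * d j)%R)%:E +
    \sum_(k <oo) (Lam (f k * r J)%R)%:E <= S + eps%:E.
  rewrite -nneseries_sum // -nneseriesD //; last first.
    by move=> k _ _; exact: sume_ge0.
  apply: (@le_trans _ _ (\sum_(k <oo) ((1 + 2 * delta)%:E * (Lam (f k))%:E))).
    apply: lee_nneseries => [k _ _|k _].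
      by rewrite adde_ge0 // sume_ge0.
    rewrite sumEFin -EFinD -EFinM lee_fin -Lam_sum -LamD -mulr_sumr -mulrDr.
    rewrite -LamCM -subr_ge0 -LamB mulrC -mulrBr; apply: Lam_ge0.
    apply: box_nonnegM => // x xb.
    rewrite evalxB evalxC evalxD subr_ge0 evalx_sum.
    exact: dr.
  rewrite nneseriesZl; last by move=> k _; exact: Lam_fin_ge0.
  rewrite -/S -(fineK Sfin) -EFinM -EFinD lee_fin mulrDl mul1r lerD2l.
  have s1 : (0 < fine S + 1)%R by rewrite ltr_wpDl // fine_ge0.
  rewrite (_ : _ * _ = eps * (fine S / (fine S + 1)))%R; last first.
    by rewrite /delta; field; rewrite gt_eqF.
  by rewrite ler_piMr ?(ltW eps0) // ler_pdivrMr // mul1r lerDl.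
have out_fin : daniell_measure (A `&` ~` ball c e) \is a fin_num.
  rewrite ge0_fin_numE ?upper_integral_ge0 //.
  apply: le_lt_trans (outside 0%N) _; apply: (@le_lt_trans _ _ (S + eps%:E)).
    by apply: le_trans (total 0%N); rewrite big_ord0 add0e.
  by rewrite lte_add_pinfty ?ltry // -ge0_fin_numE.
apply: (@le_trans _ _ (\sum_(j <oo) \sum_(k <oo) (Lam (f k * d j)%R)%:E +
    daniell_measure (A `&` ~` ball c e))); first exact: leeD2r.
rewrite -leeBrDr //; apply: lime_le.
  by apply: is_cvg_nneseries => j _ _; apply: nneseries_ge0.
apply: nearW => J; rewrite leeBrDr // big_mkord.
by apply: le_trans (total J); exact: leeD2l.
Qed.

Lemma borel_caratheodory (A : set (borelRn R n)) :
  measurable A -> daniell_measure.-caratheodory A.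
Proof.
move: A; apply: smallest_sub.
  split=> [|A|A]; first exact: (caratheodory_measurable_set0 dmu).
    by rewrite setTD; exact: (@caratheodory_measurable_setC _ _ dmu).
  exact: (@caratheodory_measurable_bigcup _ _ dmu).
move=> U /open_bigcup_balls[c [e ->]].
apply: (@caratheodory_measurable_bigcup _ _ dmu) => k.
exact: ball_caratheodory.
Qed.

Lemma daniell_measure_semi_sigma_additive : semi_sigma_additive daniell_measure.
Proof.
move=> A mA tA mUA; apply: (caratheodory_measure_sigma_additive (mu := dmu)) => //.
  by move=> k; exact: borel_caratheodory.
exact: borel_caratheodory.
Qed.

Lemma daniell_measureE : exists mu : {measure set (borelRn R n) -> \bar R},
  forall A, mu A = daniell_measure A.
Proof.
pose mu : {measure set (borelRn R n) -> \bar R} :=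
  HB.pack daniell_measure (measure_function.isMeasure.Build _ (borelRn R n) R
    daniell_measure daniell_measure0 (fun A => upper_integral_ge0 _)
    daniell_measure_semi_sigma_additive).
by exists mu.
Qed.

Lemma daniell_measure_setC_box : daniell_measure (~` box b) = 0.
Proof.
apply/eqP; rewrite eq_le upper_integral_ge0 andbT.
rewrite -[leRHS]/(0%R%:E) -Lam0; apply: upper_integral_poly => x xb.
  by rewrite evalx0.
by rewrite evalx0 indicE memNset // => /(_ xb).
Qed.

(* By compactness of the box, finitely many polynomials of a cover of the
   constant 1 already sum to nearly 1. *)
Lemma daniell_measure_setT : daniell_measure setT = (Lam 1)%:E.
Proof.
apply/eqP; rewrite eq_le; apply/andP; split.
  apply: upper_integral_poly => x _; first by rewrite evalx1.
  by rewrite indicT evalx1.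
apply: le_ereal_inf_tmp => _ [f [f0 f1] <-].
have L1 : (0 <= Lam 1)%R by apply: Lam_ge0 => x _; rewrite evalx1.
apply/lee_addgt0Pr => eps eps0.
pose e : R := (eps / (Lam 1 + 1))%R.
have e0 : (0 < e)%R by rewrite divr_gt0 // ltr_wpDl.
pose S k : mpoly n R := (\sum_(j < k) f j)%R.
have SE k x : evalx (S k) x = (\sum_(j < k) evalx (f j) x)%R by rewrite evalx_sum.
have S_mono k l x : box b x -> (k <= l)%N -> (evalx (S k) x <= evalx (S l) x)%R.
  move=> xb kl; rewrite !SE -!(big_mkord xpredT (fun j => evalx (f j) x)).
  rewrite [leRHS](@big_cat_nat _ _ _ k) //= lerDl sumr_ge0 // => j _.
  exact: f0.
pose U k : set 'rV[R]_n := evalx (S k) @^-1` [set t | (1 - e < t)%R].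
have Uo k : open (U k).
  apply: open_comp; last exact: open_gt.
  by move=> x _; exact: evalx_continuous.
have := @box_compact R n b; rewrite compact_cover => /(_ nat setT U).
case=> [k _|x xb|D _ boxD]; first exact: Uo.
  have xe : ((1 - e)%R%:E < \sum_(k <oo) (evalx (f k) x)%:E)%E.
    apply: lt_le_trans (f1 x xb); rewrite indicT lte_fin /=; lra.
  have [k _ kx] : exists2 k, True & (1 - e < evalx (S k) x)%R.
    apply: contrapT => nk; move: xe; rewrite ltNge => /negP; apply.
    apply: lime_le.
      by apply: is_cvg_nneseries => k _ _; rewrite lee_fin f0.
    apply: nearW => k; rewrite sumEFin lee_fin big_mkord -SE leNgt.
    by apply/negP => kx; apply: nk; exists k.
  by exists k.
pose N := (\max_(k <- finmap.enum_fset D) k)%N.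
have NU x : box b x -> (1 - e <= evalx (S N) x)%R.
  move=> xb; have [k /= kD kx] := boxD x xb.
  by rewrite (le_trans (ltW kx)) // S_mono // leq_bigmax_seq.
have LS : (Lam 1 - e * Lam 1 <= Lam (S N))%R.
  rewrite -subr_ge0 -LamCM -!LamB; apply: Lam_ge0 => x xb.
  by rewrite !evalxB evalxM evalxC evalx1 mulr1 subr_ge0 NU.
have LN : (Lam (S N))%:E <= \sum_(k <oo) (Lam (f k))%:E.
  rewrite Lam_sum -sumEFin -(big_mkord xpredT (fun k => (Lam (f k))%:E)).
  by apply: nneseries_lim_ge => k _ _; exact: Lam_fin_ge0.
have eL : (e * Lam 1 <= eps)%R.
  rewrite /e mulrAC -mulrA ler_piMr ?(ltW eps0) // ler_pdivrMr ?ltr_wpDl //.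
  by rewrite mul1r lerDl.
apply: le_trans (leeD2r _ LN); rewrite -EFinD lee_fin; lra.
Qed.

End DaniellOuterMeasure.

(** * Moments of the Daniell measure *)

Import HBNNSimple.

Section BoxIntegral.
Context {R : realType} {n : nat}.
Implicit Types (p q : mpoly n R) (b : R).
Implicit Types mu : {measure set (borelRn R n) -> \bar R}.

Lemma evalx_bounded b p :
  exists2 M : R, 0 <= M & forall x, box b x -> `|evalx p x| <= M.
Proof.
elim/mpoly_ring_ind: p => [c|i|p q [M M0 Mp] [N N0 Nq]|p q [M M0 Mp] [N N0 Nq]].
- by exists `|c| => // x _; rewrite evalxC.
- by exists `|b| => // x xb; rewrite evalxX (le_trans (xb i)) ?ler_norm.
- exists (M + N) => [|x xb]; first exact: addr_ge0.
  by rewrite evalxD (le_trans (ler_normD _ _)) // lerD ?Mp ?Nq.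
- exists (M * N) => [|x xb]; first exact: mulr_ge0.
  by rewrite evalxM normrM ler_pM ?Mp ?Nq.
Qed.

Lemma measurable_box b : measurable (box b : set (borelRn R n)).
Proof. by apply: closed_borel_measurable; exact: box_closed. Qed.

Lemma bounded_integrable mu (D : set (borelRn R n)) (f : borelRn R n -> R)
    (M : R) :
  measurable D -> (mu D < +oo)%E -> measurable_fun D f ->
  (forall x, D x -> `|f x| <= M) -> mu.-integrable D (EFin \o f).
Proof.
move=> mD muD mf fM; apply: measurable_bounded_integrable => //.
exists M; split; first exact: num_real.
by move=> N MN x Dx; exact: le_trans (fM x Dx) (ltW MN).
Qed.

Lemma integrable_evalx mu b p : (mu (box b) < +oo)%E ->
  mu.-integrable (box b) (EFin \o evalx p).
Proof.
move=> mub; have [M _ Mp] := evalx_bounded b p.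
apply: (bounded_integrable _ mub _ Mp); first exact: measurable_box.
by apply: measurable_funTS; exact: measurable_evalx.
Qed.

End BoxIntegral.

Section RieszMoments.
Local Open Scope ereal_scope.
Context {R : realType} {n : nat} (b : R).
Hypothesis b_gt0 : (0 < b)%R.
Implicit Types (p q f : mpoly n R) (Lam : mpoly n R -> R).
Implicit Types mu : {measure set (borelRn R n) -> \bar R}.

Definition positive_on_box Lam : Prop :=
  scalar Lam /\ forall p, box_nonneg b p -> (0 <= Lam p)%R.

Lemma positive_on_boxM Lam f : positive_on_box Lam -> box_nonneg b f ->
  positive_on_box (fun p => Lam (f * p)%R).
Proof.
move=> [sL L0] f0; split=> [c p q|p p0]; last by apply: L0; exact: box_nonnegM.
by rewrite mulrDr -scalerAr sL.
Qed.

(** For c > 0, if h covers A then so does f h / c, because f / c >= 1 on A; its cost under Lam is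
    the cost of h under Lam (f * _), divided by c. *)
Lemma le_daniell_measureM Lam f (c : R) (A : set (borelRn R n)) :
  positive_on_box Lam ->
  box_nonneg b f -> (0 <= c)%R ->
  (forall x, box b x -> A x -> (c <= evalx f x)%R) ->
  c%:E * daniell_measure b Lam A <= daniell_measure b (fun p => Lam (f * p)%R) A.
Proof.
move=> posL f0; rewrite le_eqVlt => /orP[/eqP<- _|c0 fc].
  by rewrite mul0e; apply: upper_integral_ge0; exact: (positive_on_boxM posL f0).2.
apply: le_ereal_inf_tmp => _ [h [h0 Ah] <-]; rewrite -lee_pdivlMl //.
rewrite -nneseriesZl; last first.
  by move=> k _; rewrite lee_fin; apply: posL.2; exact: box_nonnegM.
have fh0 k : box_nonneg b (mpolyC n c^-1 * (f * h k))%R.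
  move=> x xb; rewrite evalxM evalxC; apply: mulr_ge0.
    by rewrite invr_ge0 ltW.
  exact: (box_nonnegM f0 (h0 k) xb).
apply: ereal_inf_lbound; exists (fun k => (mpolyC n c^-1 * (f * h k))%R).
  split=> // x xb; rewrite indicE.
  have [/set_mem xA|_] := boolP (x \in A); last first.
    by apply: nneseries_ge0 => k _ _; rewrite lee_fin fh0.
  apply: (@le_trans _ _ (\1_A x)%:E); first by rewrite indicE mem_set.
  apply: le_trans (Ah x xb) _; apply: lee_nneseries => [k _ _|k _].
    by rewrite lee_fin h0.
  rewrite lee_fin !evalxM evalxC mulrA ler_peMl ?h0 //.
  by rewrite mulrC ler_pdivlMr // mul1r fc.
apply: eq_eseriesr => k _; rewrite mul_mpolyC.
by rewrite (scalar_mapZ posL.1) EFinM.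
Qed.

(** The Daniell measure nu of Lam (f * _) has total mass Lam f. For a simple function h <= f, c mu
    (h = c) <= nu (h = c) on each level set, and the level sets are disjoint. *)
Lemma integral_poly_le mu Lam f : positive_on_box Lam ->
  (forall A, mu A = daniell_measure b Lam A) -> box_nonneg b f ->
  \int[mu]_(x in box b) (evalx f x)%:E <= (Lam f)%:E.
Proof.
move=> posL muE f0; have [sLf Lf0] := positive_on_boxM posL f0.
have [nu nuE] := daniell_measureE sLf Lf0 b_gt0.
have -> : (Lam f)%:E = nu setT by rewrite nuE daniell_measure_setT // mulr1.
rewrite ge0_integralE => [|x xb]; last by rewrite lee_fin f0.
apply: ge_ereal_sup => _ [h /= hf <-]; rewrite sintegralE.
apply: (@le_trans _ _ (\sum_(c \in range h) nu (h @^-1` [set c]))).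
  apply: lee_fsum => // _ [t _ <-]; rewrite muE nuE.
  apply: le_daniell_measureM => // x xb hx.
  by have := hf x; rewrite patchE mem_set // lee_fin [h x]hx.
rewrite -measure_fin_bigcup //.
  by apply: le_measure; rewrite ?inE //; apply: fin_bigcup_measurable.
exact: trivIset_preimage1.
Qed.

Theorem riesz_box Lam : positive_on_box Lam ->
  exists mu : {measure set (borelRn R n) -> \bar R},
  [/\ forall A, mu A = daniell_measure b Lam A,
      mu (~` box b) = 0 &
      forall p, \int[mu]_(x in box b) (evalx p x)%:E = (Lam p)%:E].
Proof.
move=> posL; have [mu muE] := daniell_measureE posL.1 posL.2 b_gt0.
have mubC : mu (~` box b) = 0.
  by rewrite muE (daniell_measure_setC_box posL.1 posL.2).
exists mu; split=> // p.
have mb : measurable (box b : set (borelRn R n)) by exact: measurable_box.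
have mub : mu (box b) = (Lam 1)%:E.
  rewrite -(daniell_measure_setT posL.1 posL.2) -muE -[setT](setUv (box b)).
  rewrite measureU ?setICr //; last exact: measurableC.
  by rewrite [X in _ + X]mubC adde0.
have mubfin : mu (box b) < +oo by rewrite mub ltry.
have LamD := scalar_mapD posL.1; have LamZ := scalar_mapZ posL.1.
have [M M0 Mp] := evalx_bounded b p.
have ip (q : mpoly n R) := integrable_evalx q mubfin.
have int_shift (s : R) :
    \int[mu]_(x in box b) (evalx (mpolyC n M + s *: p)%R x)%:E =
    (M * Lam 1)%:E + s%:E * \int[mu]_(x in box b) (evalx p x)%:E.
  rewrite (eq_integral (fun x : borelRn R n =>
      M%:E + s%:E * (evalx p x)%:E)); last first.
    by move=> x _; rewrite -mul_mpolyC evalxD evalxM !evalxC.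
  rewrite integralD //=.
  - rewrite integral_cst // [X in M%:E * X]mub integralZl //; exact: ip.
  - by have := ip (mpolyC n M); apply: eq_integrable => // x _ /=; rewrite evalxC.
  - by apply: integrableZl => //; exact: ip.
(* Applied to M + p and M - p, which are nonnegative on the box, the one-sided estimate becomes an
   equality for p, since the constant M integrates exactly to M Lam 1. *)
have le_shift (s : R) : (`|s| <= 1)%R ->
    (M * Lam 1)%:E + s%:E * \int[mu]_(x in box b) (evalx p x)%:E <=
    (M * Lam 1 + s * Lam p)%:E.
  move=> s1; rewrite -int_shift -[(s * Lam p)%R]LamZ.
  have -> : (M * Lam 1 + Lam (s *: p) = Lam (mpolyC n M + s *: p))%R.
    by rewrite LamD -[mpolyC n M]mulr1 mul_mpolyC !LamZ.
  apply: integral_poly_le => // x xb.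
  rewrite -mul_mpolyC evalxD evalxM !evalxC.
  have := Mp x xb; rewrite ler_norml => /andP[p1 p2].
  have : (`|s * evalx p x| <= M)%R.
    by rewrite normrM -[leRHS]mul1r ler_pM ?Mp.
  by rewrite ler_norml; lra.
have fin : \int[mu]_(x in box b) (evalx p x)%:E \is a fin_num.
  by apply: integrable_fin_num => //; exact: ip.
rewrite -(fineK fin); congr (_%:E); apply/eqP; rewrite eq_le; apply/andP; split.
  have := le_shift 1%R; rewrite normr1 lexx -(fineK fin) => /(_ isT).
  by rewrite -EFinM -EFinD lee_fin; lra.
have := le_shift (-1)%R; rewrite normrN normr1 lexx -(fineK fin) => /(_ isT).
by rewrite -EFinM -EFinD lee_fin; lra.
Qed.

Lemma positive_moments mu Lam : mu (~` box b) = 0 ->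
  (forall p, \int[mu]_(x in box b) (evalx p x)%:E = (Lam p)%:E) ->
  positive_on_box Lam.
Proof.
move=> muC muL.
have mb : measurable (box b : set (borelRn R n)) by exact: measurable_box.
have mub : mu (box b) = (Lam 1)%:E.
  rewrite -muL -[LHS]mul1e -integral_cst //.
  by apply: eq_integral => x _; rewrite evalx1.
have ip (q : mpoly n R) : mu.-integrable (box b) (EFin \o evalx q).
  by apply: integrable_evalx; rewrite mub ltry.
split=> [c p q|p p0].
  apply: EFin_inj; rewrite -muL EFinD EFinM -!muL.
  rewrite (eq_integral (fun x : borelRn R n =>
      c%:E * (evalx p x)%:E + (evalx q x)%:E)); last first.
    by move=> x _; rewrite -mul_mpolyC evalxD evalxM evalxC.
  rewrite integralD //=; [|by apply: integrableZl => //; exact: ip|exact: ip].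
  by rewrite integralZl //; exact: ip.
by rewrite -lee_fin -muL; apply: integral_ge0 => x xb; rewrite lee_fin p0.
Qed.

Theorem moments_daniell_measure mu Lam (A : set (borelRn R n)) :
  mu (~` box b) = 0 ->
  (forall p, \int[mu]_(x in box b) (evalx p x)%:E = (Lam p)%:E) ->
  measurable A -> mu A = daniell_measure b Lam A.
Proof.
move=> muC muL mA; have posL := positive_moments muC muL.
have mb : measurable (box b : set (borelRn R n)) by exact: measurable_box.
have mub : mu (box b) = (Lam 1)%:E.
  rewrite -muL -[LHS]mul1e -integral_cst //.
  by apply: eq_integral => x _; rewrite evalx1.
have muT : mu setT = (Lam 1)%:E.
  rewrite -[setT](setUv (box b)) measureU ?setICr //; last exact: measurableC.
  by rewrite [X in _ + X]muC adde0.
have [nu nuE] := daniell_measureE posL.1 posL.2 b_gt0.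
have nuT : nu setT = (Lam 1)%:E by rewrite nuE (daniell_measure_setT posL.1 posL.2).
(* The sum of a cover of B dominates the indicator of B on the box, and termwise integration gives
   mu B <= sum_k Lam (f k). *)
have le_nu B : measurable B -> mu B <= nu B.
  move=> mB; rewrite nuE; apply: le_ereal_inf_tmp => _ [f [f0 Bf] <-].
  have -> : mu B = mu (B `&` box b).
    rewrite -[in LHS](setUIDK B (box b)) measureU //.
    - rewrite [X in _ + X](_ : _ = 0) ?adde0 //; apply/eqP.
      rewrite eq_le measure_ge0 andbT -muC; apply: le_measure; rewrite ?inE //.
      + exact: measurableD.
      + exact: measurableC.
    - exact: measurableI.
    - exact: measurableD.
    - by rewrite setDE setIACA setICr setI0.
  rewrite -integral_indic //; under eq_eseriesr do rewrite -muL.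
  rewrite -integral_nneseries //; last first.
    move=> k; apply/measurable_EFinP; apply: measurable_funTS.
    exact: measurable_evalx.
  apply: ge0_le_integral => //.
  - by apply/measurable_EFinP; exact: measurable_indic.
  - apply: ge0_emeasurable_sum => [k x xb _|k _]; first by rewrite lee_fin f0.
    by apply/measurable_EFinP; apply: measurable_funTS; exact: measurable_evalx.
apply/eqP; rewrite eq_le -nuE le_nu //=.
have mCA : measurable (~` A) by exact: measurableC.
have addC (m : {measure set (borelRn R n) -> \bar R}) : m setT = (Lam 1)%:E ->
    m A = (Lam 1)%:E - m (~` A).
  move=> mT; have mAC : m A + m (~` A) = (Lam 1)%:E.
    by rewrite -mT -[setT](setUv A) measureU ?setICr.
  have fin : m (~` A) \is a fin_num.
    by rewrite ge0_fin_numE // (@le_lt_trans _ _ (Lam 1%R)%:E) ?ltry // -mAC leeDr.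
  by rewrite -mAC addeK.
by rewrite (addC mu muT) (addC nu nuT); apply: leeB => //; exact: le_nu.
Qed.

End RieszMoments.

(** * Detecting the sign of a density with polynomials *)

Section NullSets.
Local Open Scope ereal_scope.
Context d (T : measurableType d) {R : realType} (mu : {measure set T -> \bar R}).

Lemma positive_integral_null (A : set T) (f : T -> \bar R) :
  measurable A -> measurable_fun A f -> (forall x, A x -> 0 < f x) ->
  \int[mu]_(x in A) f x <= 0 -> mu A = 0.
Proof.
move=> mA mf f0 intf; apply: measure_negligible => //.
have f_eq0 : \int[mu]_(x in A) `|f x| = 0.
  rewrite (eq_integral f) => [|x /set_mem xA]; last first.
    by rewrite gee0_abs // ltW // f0.
  by apply/eqP; rewrite eq_le intf integral_ge0 // => x xA; rewrite ltW // f0.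
have /(ae_eq_integral_abs mu mA mf)[N [mN N0 fN]] := f_eq0.
exists N; split=> // x xA; apply: fN => /= /(_ xA) fx.
by have := f0 x xA; rewrite fx ltxx.
Qed.

End NullSets.

Section Density.
Local Open Scope ereal_scope.
Context {R : realType} {n : nat} (b : R).
Hypothesis b_gt0 : (0 < b)%R.
Implicit Types (p q f : mpoly n R) (Lam : mpoly n R -> R).
Implicit Types mu : {measure set (borelRn R n) -> \bar R}.

(* A polynomial cover of the set where [D < 0] whose total mass is nearly
   optimal approximates its indicator in L^1. *)
Lemma density_ge0 mu Lam (D : borelRn R n -> R) (M : R) :
  mu (~` box b) = 0 ->
  (forall p, \int[mu]_(x in box b) (evalx p x)%:E = (Lam p)%:E) ->
  measurable_fun (box b : set (borelRn R n)) D ->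
  (forall x, box b x -> (`|D x| <= M)%R) ->
  (forall f, box_nonneg b f ->
     0 <= \int[mu]_(x in box b) (evalx f x * D x)%:E) ->
  mu (box b `&` [set x | (D x < 0)%R]) = 0.
Proof.
move=> muC muL mD DM pD.
have mb : measurable (box b : set (borelRn R n)) by exact: measurable_box.
have posL := positive_moments muC muL.
set A : set (borelRn R n) := _ `&` _.
have mA : measurable A.
  rewrite (_ : A = box b `&` (D @^-1` [set` Interval -oo%O (BLeft 0%R)])).
    exact: mD.
  by apply/seteqP; split=> x /=; rewrite in_itv.
have Ab : A `<=` box b by move=> x [].
pose B : set (borelRn R n) := box b `\` A.
have mB : measurable B by exact: measurableD.
have AB : box b = A `|` B by rewrite setDUK.
have dAB : [disjoint A & B].
  by apply/disj_set2P/seteqP; split=> x // [xA [_ nxA]]; exact: nxA.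
have muAfin : mu A < +oo.
  apply: (@le_lt_trans _ _ (mu (box b))); first by apply: le_measure; rewrite ?inE.
  have -> : mu (box b) = (Lam 1%R)%:E; last exact: ltry.
  rewrite -muL -[LHS]mul1e -integral_cst //.
  by apply: eq_integral => x _; rewrite evalx1.
have M0 : (0 <= M)%R.
  have : box b (0%R : 'rV[R]_n) by move=> i; rewrite mxE normr0 ltW.
  by move/DM; apply: le_trans.
have mp (E : set (borelRn R n)) p : measurable_fun E (evalx p : borelRn R n -> R).
  by apply: measurable_funTS; exact: measurable_evalx.
have mDA : measurable_fun A D by apply: measurable_funS mD.
have mDB : measurable_fun B D by apply: measurable_funS mD => // x [].
apply: (positive_integral_null (f := fun x => (- D x)%:E)) => //.
- by apply/measurable_EFinP; exact: measurableT_comp.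
- by move=> x [_ Dx]; rewrite lte_fin oppr_gt0.
apply/lee_addgt0Pr => eps eps0; rewrite add0e.
pose e : R := (eps / (M + 1))%R.
have e0 : (0 < e)%R by rewrite divr_gt0 // ltr_wpDl.
have muAE : mu A = daniell_measure b Lam A.
  exact: (moments_daniell_measure b_gt0 muC muL).
have muAf : mu A \is a fin_num by rewrite ge0_fin_numE.
have := muAf; rewrite muAE => /(lb_ereal_inf_adherent e0).
rewrite -/(upper_integral _ _ _) -/(daniell_measure _ _ _) -muAE.
move=> [_ [f [f0 Af] <-] /ltW fe].
have fint k : (Lam (f k))%:E =
    \int[mu]_(x in A) (evalx (f k) x)%:E + \int[mu]_(x in B) (evalx (f k) x)%:E.
  rewrite -muL AB ge0_integral_setU //.
  - by apply/measurable_EFinP; exact: mp.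
  - by rewrite -AB => x xb; rewrite lee_fin f0.
have intB0 k : 0 <= \int[mu]_(x in B) (evalx (f k) x)%:E.
  by apply: integral_ge0 => x [xb _]; rewrite lee_fin f0.
have intA0 k : 0 <= \int[mu]_(x in A) (evalx (f k) x)%:E.
  by apply: integral_ge0 => x [xb _]; rewrite lee_fin f0.
(* The cover costs at most mu A + e and contributes at least mu A on A itself, where its sum is at
   least 1. *)
have outA : \sum_(k <oo) \int[mu]_(x in B) (evalx (f k) x)%:E <= e%:E.
  rewrite -(leeD2lE _ _ muAf); apply: le_trans fe.
  have -> : \sum_(k <oo) (Lam (f k))%:E =
      \sum_(k <oo) \int[mu]_(x in A) (evalx (f k) x)%:E +
      \sum_(k <oo) \int[mu]_(x in B) (evalx (f k) x)%:E.
    by rewrite -nneseriesD //; apply: eq_eseriesr => k _; exact: fint.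
  apply: leeD2r; rewrite -integral_nneseries //.
  - rewrite -[leLHS]mul1e -integral_cst //; apply: ge0_le_integral => //.
    + apply: ge0_emeasurable_sum => [k x [xb _] _|k _]; first by rewrite lee_fin f0.
      by apply/measurable_EFinP; exact: mp.
    + by move=> x xA; have := Af x (Ab x xA); rewrite indicE mem_set.
  - by move=> k; apply/measurable_EFinP; exact: mp.
  - by move=> k x [xb _]; rewrite lee_fin f0.
(* The nonnegative integral of f k * D bounds the contribution of A by that of B, where 0 <= D <= M.
   Summed over k, this gives at most M e <= eps. *)
have step k : \int[mu]_(x in A) (evalx (f k) x * - D x)%:E <=
    M%:E * \int[mu]_(x in B) (evalx (f k) x)%:E.
  have mfD (E : set (borelRn R n)) : measurable_fun E D ->
      measurable_fun E (fun x => (evalx (f k) x * D x)%:E).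
    by move=> mE; apply/measurable_EFinP; apply: measurable_funM.
  have := pD (f k) (f0 k); rewrite AB integral_setU //; last first.
    by apply: mfD; rewrite -AB.
  have -> : \int[mu]_(x in A) (evalx (f k) x * D x)%:E =
      - \int[mu]_(x in A) (evalx (f k) x * - D x)%:E.
    rewrite -integral_ge0N; last first.
      by move=> x [xb Dx]; rewrite lee_fin mulr_ge0 ?f0 // oppr_ge0 ltW.
    by apply: eq_integral => x _; rewrite mulrN EFinN oppeK.
  have [N N0 fN] := evalx_bounded b (f k).
  have fin : \int[mu]_(x in A) (evalx (f k) x * - D x)%:E \is a fin_num.
    apply: integrable_fin_num => //.
    apply: (bounded_integrable (M := N * M)) => //.
      by apply: measurable_funM => //; exact: measurableT_comp.
    by move=> x [xb _]; rewrite normrM normrN ler_pM ?fN ?DM.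
  rewrite addeC sube_ge0 ?fin // => /le_trans; apply.
  rewrite -ge0_integralZl_EFin //; last 2 first.
  - by move=> x [xb _]; rewrite lee_fin f0.
  - by apply/measurable_EFinP; exact: mp.
  apply: ge0_le_integral => //.
  - move=> x [xb nA]; rewrite lee_fin mulr_ge0 ?f0 // leNgt.
    by apply/negP => Dx; apply: nA.
  - exact: mfD.
  - by apply: measurable_funeM; apply/measurable_EFinP; exact: mp.
  - move=> x [xb _]; rewrite lee_fin mulrC ler_wpM2r ?f0 //.
    by rewrite (le_trans (ler_norm _)) ?DM.
apply: (@le_trans _ _ (\sum_(k <oo) \int[mu]_(x in A) (evalx (f k) x * - D x)%:E)).
  rewrite -integral_nneseries //; last 2 first.
  - move=> k; apply/measurable_EFinP; apply: measurable_funM => //.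
    exact: measurableT_comp.
  - by move=> k x [xb Dx]; rewrite lee_fin mulr_ge0 ?f0 // oppr_ge0 ltW.
  apply: ge0_le_integral => //.
  - by move=> x [_ Dx]; rewrite lee_fin oppr_ge0 ltW.
  - by apply/measurable_EFinP; exact: measurableT_comp.
  - apply: ge0_emeasurable_sum => [k x [xb Dx] _|k _].
      by rewrite lee_fin mulr_ge0 ?f0 // oppr_ge0 ltW.
    apply/measurable_EFinP; apply: measurable_funM => //.
    exact: measurableT_comp.
  - move=> x [xb Dx]; have := Af x xb; rewrite indicE mem_set; last by split.
    move=> f1; under eq_eseriesr do rewrite mulrC EFinM.
    rewrite nneseriesZl; last by move=> k _; rewrite lee_fin f0.
    by rewrite -[leLHS]mule1; apply: lee_wpmul2l => //; rewrite lee_fin oppr_ge0 ltW.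
apply: (@le_trans _ _ (\sum_(k <oo) M%:E * \int[mu]_(x in B) (evalx (f k) x)%:E)).
  apply: lee_nneseries => // k _ _; apply: integral_ge0 => x [xb Dx].
  by rewrite lee_fin mulr_ge0 ?f0 // oppr_ge0 ltW.
rewrite nneseriesZl //; apply: (@le_trans _ _ (M%:E * e%:E)).
  exact: lee_wpmul2l.
rewrite -EFinM lee_fin /e mulrCA ler_piMr ?(ltW eps0) //.
by rewrite ler_pdivrMr ?mul1r ?lerDl // ltr_wpDl.
Qed.

End Density.

(** * Supports and bounded densities *)

Section FiniteMeasureOf.
Context d (T : measurableType d) (R : realType) (mu : {measure set T -> \bar R}).

(** A synonym of [mu] that carries the proof of finiteness as an argument, so that the structure of
    finite measure can be attached to a measure obtained from an existential statement. *)
Definition finite_measure_of (mu_fin : fin_num_fun mu) : set T -> \bar R := mu.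

Context (mu_fin : fin_num_fun mu).

HB.instance Definition _ :=
  measure_function.Measure.copy (finite_measure_of mu_fin) mu.
HB.instance Definition _ :=
  Measure_isFinite.Build d T R (finite_measure_of mu_fin) mu_fin.

End FiniteMeasureOf.

Section ProbabilityOf.
Context d (T : measurableType d) (R : realType) (mu : {measure set T -> \bar R}).

Definition probability_of (mu1 : mu setT = 1%E) : set T -> \bar R := mu.

Context (mu1 : mu setT = 1%E).

HB.instance Definition _ :=
  measure_function.Measure.copy (probability_of mu1) mu.
HB.instance Definition _ :=
  Measure_isProbability.Build d T R (probability_of mu1) mu1.

End ProbabilityOf.

Lemma nbhs_open (T : topologicalType) (A : set T) :
  (forall x, A x -> nbhs x A) -> open A.
Proof. by rewrite openE. Qed.

Section Support.
Local Open Scope ereal_scope.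
Context {R : realType} {n : nat} (mu : {measure set (borelRn R n) -> \bar R}).

Lemma not_msupport (x : 'rV[R]_n) : ~ msupport mu x ->
  exists2 U : set 'rV[R]_n, open U /\ U x & mu U = 0.
Proof.
move=> nx; apply: contrapT => nU; apply: nx => U oU Ux.
rewrite lt_neqAle measure_ge0 andbT; apply/eqP => U0.
by apply: nU; exists U.
Qed.

Lemma msupport_closed : closed (msupport mu : set 'rV[R]_n).
Proof.
rewrite -[msupport mu]setCK; apply: open_closedC; apply: nbhs_open => x nx.
have [U [oU Ux] U0] := not_msupport nx.
apply: filterS (open_nbhs_nbhs (conj oU Ux)) => y Uy ys.
by have := ys U oU Uy; rewrite U0 ltxx.
Qed.

Lemma measurable_msupport : measurable (msupport mu).
Proof. exact: closed_borel_measurable msupport_closed. Qed.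

(** The complement of the support is a union of null open sets, possibly uncountable;
    [lindelof_balls] reduces it to countably many negligible balls. *)
Lemma msupport_setC_null : mu (~` msupport mu) = 0.
Proof.
apply: measure_negligible; first exact: measurableC measurable_msupport.
have [||c [e [ce_null ce_cover]]] :=
    @lindelof_balls R n (fun V => mu.-negligible (V : set (borelRn R n))).
- exact: negligible_set0.
- by move=> V W WV /=; apply: (@negligibleS _ _ _ mu).
apply: (negligibleS _ (negligible_bigcup ce_null)) => x nx.
have [U [oU Ux] U0] := not_msupport nx; apply: ce_cover.
exists U; first exact: open_nbhs_nbhs.
by apply/negligibleP => //; exact: open_borel_measurable.
Qed.

Lemma msupport_sub_box b : mu (~` box b) = 0 -> msupport mu `<=` box b.
Proof.
move=> mub x xs; apply: contrapT => nxb.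
have := xs (~` box b) (closed_openC (@box_closed _ _ b)) nxb.
by rewrite mub ltxx.
Qed.

Lemma msupport_compact b : mu (~` box b) = 0 ->
  compact (msupport mu : set 'rV[R]_n).
Proof.
move=> mub; apply: subclosed_compact (msupport_closed) (@box_compact _ _ b) _.
exact: msupport_sub_box.
Qed.

(** The bridge between [represents], which integrates over the support, and the moment results,
    which integrate over a box. *)
Lemma integral_msupport (D : set (borelRn R n)) (F : borelRn R n -> \bar R) :
  measurable D -> msupport mu `<=` D -> measurable_fun D F ->
  \int[mu]_(x in msupport mu) F x = \int[mu]_(x in D) F x.
Proof.
move=> mD sD mF; have ms := measurable_msupport.
have DE : D = msupport mu `|` D `\` msupport mu by rewrite setDUK.
have mDs : measurable (D `\` msupport mu) by exact: measurableD.
rewrite [in RHS]DE integral_setU //; last 2 first.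
- by rewrite -DE.
- by apply/disj_set2P/seteqP; split=> x // [xs [_ nxs]]; exact: nxs.
rewrite [X in _ + X]null_set_integral ?adde0 //.
  by apply: measurable_funS mF => // x [].
apply/eqP; rewrite eq_le measure_ge0 andbT -msupport_setC_null.
by apply: le_measure; rewrite ?inE //; exact: measurableC.
Qed.

End Support.

(** Open sets are countable unions of balls, and a ball of the sup norm is a finite intersection of
    conditions on single coordinates. *)
Lemma measurable_rV {R : realType} {d} {T : measurableType d} {r : nat}
    (D : set T) (t : T -> borelRn R r) : measurable D ->
  (forall k, measurable_fun D (fun x => (t x : 'rV[R]_r) ord0 k)) ->
  measurable_fun D t.
Proof.
move=> mD mt.
apply: (@measurability _ _ T (borelRn R r) D t (@open 'rV[R]_r) (erefl _)).
move=> _ [_ /open_bigcup_balls[c [e ->]] <-].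
rewrite preimage_bigcup setI_bigcupr; apply: bigcupT_measurable => k.
(* A ball of radius at most 0 is empty, whereas for r = 0 the intersection over the coordinates
   imposes no condition. *)
have [e0|e0] := leP (e k) 0.
  rewrite (_ : _ `&` _ = set0) //; apply/seteqP; split=> x // [_].
  by move=> [/lt_le_trans /(_ e0)]; rewrite ltxx.
rewrite (_ : _ `&` _ = D `&` \bigcap_(i in [set: 'I_r])
    (D `&` (fun x => (t x : 'rV[R]_r) ord0 i) @^-1` (ball (c k ord0 i) (e k)))).
  apply: measurableI => //; apply: fin_bigcap_measurable => // i _.
  by apply: mt => //; exact: measurable_ball.
apply/seteqP; split=> x [Dx].
  by move=> [_ bx]; split=> // i _; split => //; exact: bx.
by move=> bx; split=> //; split=> // i j; rewrite ord1; have [] := bx j I.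
Qed.

Lemma measurable_coord {R : realType} {d} {T : measurableType d} {r : nat}
    (D : set T) (t : T -> borelRn R r) k : measurable_fun D t ->
  measurable_fun D (fun x => (t x : 'rV[R]_r) ord0 k).
Proof.
move=> mt.
have mk : measurable_fun [set: borelRn R r]
    (fun y : borelRn R r => (y : 'rV[R]_r) ord0 k).
  by apply: continuous_borel_measurable; exact: coord_continuous.
exact: measurableT_comp mk mt.
Qed.

Section BoundedDensity.
Local Open Scope ereal_scope.
Context {R : realType} {n : nat} (b : R).
Hypothesis b_gt0 : (0 < b)%R.
Implicit Types (p f : mpoly n R) (Lam : mpoly n R -> R).

Lemma le_daniell_measureZ Lam Lam' (N : R) (A : set (borelRn R n)) :
  (0 < N)%R -> positive_on_box b Lam -> positive_on_box b Lam' ->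
  (forall f, box_nonneg b f -> (Lam' f <= N * Lam f)%R) ->
  daniell_measure b Lam' A <= N%:E * daniell_measure b Lam A.
Proof.
move=> N0 posL posL' LL'; rewrite -lee_pdivrMl //.
apply: le_ereal_inf_tmp => _ [f [f0 Af] <-]; rewrite lee_pdivrMl //.
rewrite -nneseriesZl; last by move=> k _; rewrite lee_fin; exact: posL.2.
apply: (@le_trans _ _ (\sum_(k <oo) (Lam' (f k))%:E)).
  by apply: ereal_inf_lbound; exists f.
apply: lee_nneseries => [k _ _|k _]; first by rewrite lee_fin; exact: posL'.2.
by rewrite -EFinM lee_fin LL'.
Qed.

(** Covers are the same for both functionals, so their domination passes to the measures, nu <= N
    mu, and nu has a Radon-Nikodym density with values in [0, N] almost everywhere. Clamping it
    makes these bounds hold at every point, which is needed for a map tau that is bounded on the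
    whole support. *)
Lemma bounded_density (mu : {finite_measure set (borelRn R n) -> \bar R})
    Lam Lam' (N : R) :
  (0 < N)%R -> mu (~` box b) = 0 ->
  (forall p, \int[mu]_(x in box b) (evalx p x)%:E = (Lam p)%:E) ->
  positive_on_box b Lam' ->
  (forall f, box_nonneg b f -> (Lam' f <= N * Lam f)%R) ->
  exists rho : borelRn R n -> R,
  [/\ measurable_fun setT rho, forall x, (0 <= rho x <= N)%R &
      forall p, \int[mu]_(x in box b) (evalx p x * rho x)%:E = (Lam' p)%:E].
Proof.
move=> N0 muC muL posL' LL'; have posL := positive_moments muC muL.
have mb : measurable (box b : set (borelRn R n)) by exact: measurable_box.
have [nu0 [nuE nuC nuL]] := riesz_box b_gt0 posL'.
have le_nu A : measurable A -> nu0 A <= N%:E * mu A.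
  move=> mA; rewrite nuE (moments_daniell_measure b_gt0 muC muL) //.
  exact: le_daniell_measureZ.
have nu_fin : fin_num_fun nu0.
  move=> A mA; rewrite ge0_fin_numE //; apply: le_lt_trans (le_nu A mA) _.
  by rewrite lte_mul_pinfty ?lee_fin ?(ltW N0) // ltey_eq fin_num_measure.
pose nu : {finite_measure set (borelRn R n) -> \bar R} := finite_measure_of nu_fin.
have le_nu' A : measurable A -> nu A <= N%:E * mu A by exact: le_nu.
have nuL' p : \int[nu]_(x in box b) (evalx p x)%:E = (Lam' p)%:E by exact: nuL.
have numu : nu `<< mu.
  apply/null_content_dominatesP => A mA muA0; apply/eqP.
  by rewrite eq_le measure_ge0 andbT; have := le_nu' A mA; rewrite muA0 mule0.
pose rho0 := Radon_Nikodym (charge_of_finite_measure nu) mu.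
have rho_fin x : rho0 x \is a fin_num by exact: Radon_Nikodym_fin_num.
have rho_int : mu.-integrable setT rho0 by exact: Radon_Nikodym_integrable.
have mrho : measurable_fun setT rho0 by exact: measurable_int rho_int.
have rhoE A : measurable A -> nu A = \int[mu]_(x in A) rho0 x.
  by move=> mA; rewrite -Radon_Nikodym_integral.
pose E1 : set (borelRn R n) := [set x | rho0 x < 0].
pose E2 : set (borelRn R n) := [set x | N%:E < rho0 x].
have mE1 : measurable E1.
  rewrite -[E1]setTI (_ : E1 = rho0 @^-1` [set` Interval -oo%O (BLeft 0)]).
    by apply: mrho => //; exact: emeasurable_itv.
  by apply/seteqP; split=> x /=; rewrite in_itv.
have mE2 : measurable E2.
  rewrite -[E2]setTI (_ : E2 = rho0 @^-1` [set` Interval (BRight N%:E) +oo%O]).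
    by apply: mrho => //; exact: emeasurable_itv.
  by apply/seteqP; split=> x /=; rewrite in_itv /= andbT.
have rhoS A : measurable A -> mu.-integrable A rho0.
  by move=> mA; apply: integrableS rho_int.
have E10 : mu E1 = 0.
  apply: (positive_integral_null (f := fun x => - rho0 x)) => //.
  - by apply: measurableT_comp => //; exact: measurable_funTS.
  - by move=> x; rewrite oppe_gt0.
  - rewrite integralN; last exact: integrable_add_def (rhoS _ mE1).
    by rewrite -rhoE // oppe_le0.
have E20 : mu E2 = 0.
  apply: (positive_integral_null (f := fun x => rho0 x - N%:E)) => //.
  - apply: emeasurable_funB; first exact: measurable_funTS.
    exact: measurable_cst.
  - by move=> x; rewrite sube_gt0.
  - rewrite integralB //; [|exact: rhoS|exact: finite_measure_integrable_cst].
    by rewrite -rhoE // integral_cst // sube_le0 le_nu'.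
pose rho x : R := Num.max 0%R (Num.min N (fine (rho0 x))).
have mrhoR : measurable_fun setT rho.
  apply: measurable_maxr; first exact: measurable_cst.
  apply: measurable_minr; first exact: measurable_cst.
  exact: measurableT_comp.
exists rho; split=> //.
- move=> x; rewrite le_max lexx /= ge_max (ltW N0) /=.
  by rewrite ge_min lexx.
- move=> p; rewrite -nuL'.
  rewrite -(@Radon_Nikodym_change_of_variables _ _ _ nu mu numu) //; last first.
    by apply: integrable_evalx; rewrite ltey_eq fin_num_measure.
  apply: ae_eq_integral => //.
  + apply/measurable_EFinP; apply: measurable_funM; apply: measurable_funTS => //.
    exact: measurable_evalx.
  + apply: emeasurable_funM; last exact: measurable_funTS.
    by apply/measurable_EFinP; apply: measurable_funTS; exact: measurable_evalx.
  exists (E1 `|` E2); split; [exact: measurableU|by rewrite measureU0|].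
  move=> x /= nx; apply: contrapT => nE; apply: nx => _.
  rewrite EFinM -/rho0; congr (_ * _).
  have [n1 n2] : ~ E1 x /\ ~ E2 x by split=> Ex; apply: nE; [left|right].
  move: n1 n2; rewrite /E1 /E2 /rho /= -(fineK (rho_fin x)) !lte_fin.
  move=> /negP; rewrite -leNgt => r0 /negP; rewrite -leNgt => rN.
  by rewrite min_r // max_r.
Qed.

End BoundedDensity.

(** * Representations *)

Section VrEval.
Context {R : realType} {n r m : nat}.
Implicit Types (q s : mpoly n R) (p : Vr R n r) (x : 'rV[R]_n) (l : 'rV[R]_r).
Implicit Types g : 'I_m -> Vr R n r.

Definition Vr_lambda (k : 'I_r) : Vr R n r := (0, [ffun j => (j == k)%:R]).

Lemma Vr_eval_polyx q x l : Vr_eval (Vr_of_polyx q : Vr R n r) x l = evalx q x.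
Proof.
by rewrite /Vr_eval big1 ?addr0 // => k _; rewrite ffunE evalx0 mulr0.
Qed.

Lemma Vr_evalD p1 p2 x l : Vr_eval (p1 + p2) x l = Vr_eval p1 x l + Vr_eval p2 x l.
Proof.
rewrite /Vr_eval evalxD addrACA; congr (_ + _).
by rewrite -big_split; apply: eq_bigr => k _; rewrite ffunE evalxD mulrDr.
Qed.

Lemma Vr_eval_mulx s p x l : Vr_eval (Vr_mulx s p) x l = evalx s x * Vr_eval p x l.
Proof.
rewrite /Vr_eval /= evalxM mulrDr; congr (_ + _).
by rewrite [RHS]mulr_sumr; apply: eq_bigr => k _; rewrite ffunE evalxM mulrCA.
Qed.

Lemma Vr_eval_lambda k x l : Vr_eval (Vr_lambda k) x l = l ord0 k.
Proof.
rewrite /Vr_eval evalx0 add0r (bigD1 k) //= ffunE eqxx evalx1 mulr1.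
by rewrite big1 ?addr0 // => j /negPf jk; rewrite ffunE jk evalx0 mulr0.
Qed.

(** V_r is generated over R[x] by 1 and the lambda_k, so that L is determined by the functionals q
    -> L (q) and q -> L (q lambda_k) on R[x]. *)
Lemma Vr_lambda_decomposition p :
  p = Vr_of_polyx p.1 + \sum_k Vr_mulx (p.2 k) (Vr_lambda k).
Proof.
rewrite [LHS]surjective_pairing [RHS]surjective_pairing; congr (_, _).
  by rewrite /= raddf_sum big1 ?addr0 // => k _ /=; rewrite mulr0.
apply/ffunP => j; rewrite /= raddf_sum /= add0r sum_ffunE (bigD1 j) //=.
rewrite !ffunE eqxx mulr1 big1 ?addr0 // => k kj.
by rewrite !ffunE eq_sym (negPf kj) mulr0.
Qed.

Lemma sos_evalx_ge0 s x : sos s -> 0 <= evalx s x.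
Proof.
move=> [qs ->]; rewrite evalx_sum sumr_ge0 // => q _.
by rewrite expr2 evalxM -expr2 sqr_ge0.
Qed.

Lemma quad_module_eval_ge0 g p x l : quad_module g p -> nonneg_set g (x, l) ->
  0 <= Vr_eval p x l.
Proof.
move=> [s0 [s [ss0 ss ->]]] gx; rewrite Vr_evalD Vr_eval_polyx.
rewrite addr_ge0 ?sos_evalx_ge0 //.
have V0 : Vr_eval (0 : Vr R n r) x l = 0 by rewrite (Vr_eval_polyx 0) evalx0.
rewrite (big_morph (fun p => Vr_eval p x l) (fun p1 p2 => Vr_evalD p1 p2 x l) V0).
by apply: sumr_ge0 => i _; rewrite Vr_eval_mulx mulr_ge0 ?sos_evalx_ge0 ?gx.
Qed.

Lemma quad_moduleD g p1 p2 :
  quad_module g p1 -> quad_module g p2 -> quad_module g (p1 + p2).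
Proof.
have sosD s t : sos s -> sos t -> sos (s + t).
  by move=> [qs ->] [qt ->]; exists (qs ++ qt); rewrite big_cat.
move=> [s0 [s [ss0 ss ->]]] [t0 [t [st0 st ->]]].
exists (s0 + t0), (fun i => s i + t i).
split; [exact: sosD|by move=> i; exact: sosD|].
rewrite Vr_of_polyxD addrACA -big_split; congr (_ + _).
by apply: eq_bigr => i _; rewrite Vr_mulxDl.
Qed.

Lemma quad_module_const g (c : R) : 0 <= c ->
  quad_module g (Vr_of_polyx (mpolyC n c)).
Proof.
have sos0 : sos (0 : mpoly n R) by exists [::]; rewrite big_nil.
move=> c0; exists (mpolyC n c), (fun=> 0); split=> //.
  exists [:: mpolyC n (Num.sqrt c)].
  by rewrite big_seq1 -(rmorphXn (@mpolyC n R)) sqr_sqrtr.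
rewrite big1 ?addr0 // => i _; rewrite /Vr_mulx mul0r; congr (_, _).
by apply/ffunP => k; rewrite !ffunE mul0r.
Qed.

Lemma measurable_Vr_eval (D : set (borelRn R n))
    (t : borelRn R n -> borelRn R r) p :
  (forall k, measurable_fun D (fun x => (t x : 'rV[R]_r) ord0 k)) ->
  measurable_fun D (fun x => Vr_eval p x (t x)).
Proof.
move=> mt; apply: measurable_funD.
  by apply: measurable_funTS; exact: measurable_evalx.
apply: measurable_sum => k; apply: measurable_funM => //.
by apply: measurable_funTS; exact: measurable_evalx.
Qed.

Lemma Vr_eval_bounded (b N : R) (t : 'rV[R]_n -> 'rV[R]_r) p :
  0 <= N -> (forall x, box b x -> box N (t x)) ->
  exists M, forall x, box b x -> `|Vr_eval p x (t x)| <= M.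
Proof.
move=> N0 tN; have [M0 _ pM0] := evalx_bounded b p.1.
have /choice[M pM] : forall k, exists M,
    forall x, box b x -> `|evalx (p.2 k) x| <= M.
  by move=> k; have [M _ pM] := evalx_bounded b (p.2 k); exists M.
exists (M0 + \sum_k N * M k) => x xb.
rewrite (le_trans (ler_normD _ _)) // lerD ?pM0 //.
rewrite (le_trans (ler_norm_sum _ _ _)) // ler_sum // => k _.
by rewrite normrM ler_pM ?pM //; exact: tN.
Qed.

End VrEval.

Section Representations.
Context {R : realType} {n r m : nat} (g : 'I_m -> Vr R n r).
Context (L : {scalar Vr R n r}).
Implicit Types (q : mpoly n R) (p : Vr R n r).

Local Notation Lx := (fun q => L (Vr_of_polyx q)).

Lemma compact_sub_box (A : set 'rV[R]_n) : compact A ->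
  exists2 b0 : R, 0 < b0 & forall b, b0 <= b -> A `<=` box b.
Proof.
move=> /compact_bounded[M [_ AM]]; exists (`|M| + 1).
  by rewrite ltr_pwDr.
move=> b bM x Ax i; rewrite (le_trans (norm_coord_le _ _)) //.
rewrite (le_trans _ bM) //; apply: (AM (`|M| + 1)) => //.
by rewrite ltr_pwDr // ler_norm.
Qed.

Lemma represents_box mu tau b : represents g L mu tau ->
  msupport mu `<=` box b ->
  mu (~` box b) = 0%E /\
  forall q, (\int[mu]_(x in box b) (evalx q x)%:E = (Lx q)%:E)%E.
Proof.
move=> [_ mtau _ _ LE] sb; have mb := measurable_box (n := n) b; split.
  apply/eqP; rewrite eq_le measure_ge0 andbT -(msupport_setC_null mu).
  apply: le_measure; rewrite ?inE //; try exact: measurableC.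
  - by apply: measurableC; exact: measurable_msupport.
  - exact: subsetC.
move=> q; rewrite LE -(integral_msupport (D := box b)) //.
  by apply: eq_integral => x _; rewrite Vr_eval_polyx.
apply/measurable_EFinP; apply: measurable_funTS; exact: measurable_evalx.
Qed.

(** Off a null set, (x, tau x) lies in K, where every element of the quadratic module is
    nonnegative; the null set is cut out of the integral. *)
Lemma represents_positive mu tau : represents g L mu tau ->
  L (Vr_of_polyx 1) = 1 /\ forall p, quad_module g p -> 0 <= L p.
Proof.
move=> [_ mtau _ Kae LE]; have ms := measurable_msupport mu.
have mus : (mu (msupport mu) = 1)%E.
  rewrite -(probability_setT mu) -[in RHS](setUv (msupport mu)).
  rewrite measureU ?setICr //; last exact: measurableC.
  by rewrite [X in (_ + X)%E]msupport_setC_null adde0.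
split.
  apply: EFin_inj; rewrite LE -mus -[RHS]mul1e -integral_cst //.
  by apply: eq_integral => x _; rewrite Vr_eval_polyx evalx1.
move=> p Mp; rewrite -lee_fin LE.
have mF : measurable_fun (msupport mu) (fun x => (Vr_eval p x (tau x))%:E).
  apply/measurable_EFinP; apply: measurable_Vr_eval => k.
  exact: measurable_coord.
move: Kae => [N [mN N0 KN]].
rewrite -(setUIDK (msupport mu) N) integral_setU //.
- rewrite null_set_integral ?add0e.
  + apply: integral_ge0 => x [xs nN]; rewrite lee_fin.
    apply: quad_module_eval_ge0 Mp _; apply: contrapT => nK.
    by apply: nN; apply: KN => /= /(_ xs).
  + exact: measurableI.
  + by apply: measurable_funS mF => // x [].
  + apply/eqP; rewrite eq_le measure_ge0 andbT -N0.
    by apply: le_measure; rewrite ?inE //; exact: measurableI.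
- exact: measurableI.
- exact: measurableD.
- by rewrite setUIDK.
- by apply/disj_set2P/seteqP; split=> x // [[_ xN] [_ nN]].
Qed.

End Representations.

(** * Existence of a representation *)

Section Existence.
Context {R : realType} {n r m : nat} (g : 'I_m -> Vr R n r).
Context (L : {scalar Vr R n r}).
Implicit Types (q : mpoly n R) (p h : Vr R n r).
Hypothesis g_arch : restricted_archimedean g.
Hypothesis L1 : L (Vr_of_polyx 1) = 1.
Hypothesis L_ge0 : forall p, quad_module g p -> 0 <= L p.

Local Notation XP i := (mpolyX R (mnm1 i) : mpoly n R).
Local Notation C := (@mpolyC n R).

Lemma archimedean_box : exists2 b : R, 0 < b &
  forall i, quad_module g (Vr_of_polyx (C b ^+ 2 - XP i ^+ 2)).
Proof.
have /choice[N NP] : forall i : 'I_n, exists N : R,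
    0 < N /\ quad_module g (Vr_of_polyx (C N - XP i ^+ 2)).
  move=> i; have [N [N0 _ MN]] := g_arch (Vr_of_polyx (XP i ^+ 2)).
  by exists N; rewrite Vr_of_polyxB.
have N_ge0 i : 0 <= N i by have [/ltW] := NP i.
have S0 : 0 <= \sum_i N i by exact: sumr_ge0.
(* One b for all coordinates: b >= 1 and b >= N i give b^2 >= N i, and adding the nonnegative
   constant b^2 - N i to N i - x_i^2 stays in the module. *)
exists (1 + \sum_i N i) => [|i]; first by rewrite ltr_wpDr.
have Nb : 0 <= (1 + \sum_i N i) ^+ 2 - N i.
  have NS : N i <= \sum_i N i by rewrite (bigD1 i) //= lerDl sumr_ge0.
  by rewrite subr_ge0 expr2 (le_trans NS) //; nra.
have := quad_moduleD (quad_module_const g Nb) (NP i).2; congr quad_module.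
by rewrite -Vr_of_polyxD; congr Vr_of_polyx; rewrite mpolyCB; ring.
Qed.

Lemma positive_represented : exists (mu : probability (borelRn R n) R)
  (tau : borelRn R n -> borelRn R r), represents g L mu tau.
Proof.
have [b b_gt0 b_box] := archimedean_box.
have mb := measurable_box (n := n) b.
have pos h : quad_module g h -> positive_on_box b (fun q => L (Vr_mulx q h)).
  move=> Mh; split=> [c p q|p p0].
    by rewrite Vr_mulxDl Vr_mulxZl linearD linearZ.
  apply: (moment_cone_mulx_ge0 L_ge0 b_gt0 g_arch b_box) => //.
  exact: (quad_module_moment_cone L_ge0 Mh).
pose Lx q := L (Vr_of_polyx q).
have LxC q c : L (Vr_mulx q (Vr_of_polyx (C c))) = c * Lx q.
  by rewrite Vr_mulx_polyx mulrC mul_mpolyC Vr_of_polyxZ linearZ.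
have posx : positive_on_box b Lx.
  have := pos _ (quad_module_const g ler01); congr positive_on_box.
  by apply/funext => q; rewrite LxC mul1r.
have [mu0 [_ mu0C mu0L]] := riesz_box b_gt0 posx.
have mu0T : mu0 setT = 1%E.
  rewrite -[setT](setUv (box b : set (borelRn R n))).
  rewrite measureU ?setICr //; last exact: measurableC.
  rewrite [X in (_ + X)%E]mu0C adde0 -L1 -[X in X%:E]/(Lx 1) -mu0L.
  rewrite -[LHS]mul1e -integral_cst //.
  by apply: eq_integral => x _; rewrite evalx1.
pose mu : probability (borelRn R n) R := probability_of mu0T.
have muC : mu (~` box b) = 0%E by exact: mu0C.
have muL q : (\int[mu]_(x in box b) (evalx q x)%:E = (Lx q)%:E)%E by exact: mu0L.
have /choice[N NP] : forall k : 'I_r, exists N : R, [/\ 0 < N,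
    quad_module g (Vr_of_polyx (C N) + Vr_lambda k) &
    quad_module g (Vr_of_polyx (C N) - Vr_lambda k)].
  by move=> k; exact: g_arch.
have N0 k : 0 < N k by have [] := NP k.
(* The bound 2 N k comes from the other half of the Archimedean condition: 2 N k - (N k + lambda_k)
   = N k - lambda_k is in the module, which gives the domination required by [bounded_density]. *)
have /choice[rho rhoP] : forall k : 'I_r, exists rho : borelRn R n -> R,
  [/\ measurable_fun setT rho, forall x, 0 <= rho x <= 2 * N k &
      forall q, (\int[mu]_(x in box b) (evalx q x * rho x)%:E =
        (L (Vr_mulx q (Vr_of_polyx (C (N k)) + Vr_lambda k)))%:E)%E].
  move=> k; have [_ Mk1 Mk2] := NP k.
  apply: (bounded_density b_gt0 _ muC muL) (pos _ Mk1) _; first by rewrite mulr_gt0.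
  move=> f f0; have := (pos _ Mk2).2 f f0.
  rewrite !Vr_mulxDr !linearD /= LxC Vr_mulxNr linearN; lra.
pose tau (x : borelRn R n) : borelRn R r := \row_k (rho k x - N k).
have tauE x k : (tau x : 'rV[R]_r) ord0 k = rho k x - N k by rewrite mxE.
have mtau k D : measurable_fun D (fun x => (tau x : 'rV[R]_r) ord0 k).
  rewrite (_ : (fun x => _) = fun x => rho k x - N k); last first.
    by apply/funext => x; rewrite tauE.
  apply: measurable_funB; last exact: measurable_cst.
  by apply: measurable_funTS; have [] := rhoP k.
pose S := \sum_k N k.
have S0 : 0 <= S by apply: sumr_ge0 => k _; exact/ltW.
have tauS x : box S (tau x : 'rV[R]_r).
  move=> k; rewrite tauE; have [_ /(_ x)/andP[r0 rN] _] := rhoP k.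
  have NS : N k <= S by rewrite /S (bigD1 k) //= lerDl sumr_ge0 // => j _; exact/ltW.
  by rewrite ler_norml; apply/andP; split; lra.
have mubfin : (mu (box b) < +oo)%E by rewrite ltey_eq fin_num_measure.
have int_bounded (F : borelRn R n -> R) M :
    measurable_fun (box b : set (borelRn R n)) F ->
    (forall x, box b x -> `|F x| <= M) -> mu.-integrable (box b) (EFin \o F).
  exact: bounded_integrable.
have mq q (D : set (borelRn R n)) : measurable_fun D (evalx q : borelRn R n -> R).
  by apply: measurable_funTS; exact: measurable_evalx.
have iq q : mu.-integrable (box b) (EFin \o evalx q) by exact: integrable_evalx.
have iqtau q k : mu.-integrable (box b)
    (fun x => ((tau x : 'rV[R]_r) ord0 k * evalx q x)%:E).
  have [M M0 qM] := evalx_bounded b q; apply: (int_bounded _ (S * M)).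
    by apply: measurable_funM.
  by move=> x xb; rewrite normrM ler_pM ?qM //; exact: tauS.
have Llambda q k :
    (\int[mu]_(x in box b) ((tau x : 'rV[R]_r) ord0 k * evalx q x)%:E =
    (L (Vr_mulx q (Vr_lambda k)))%:E)%E.
  have [mrho rho_bd rhoL] := rhoP k.
  have iqrho : mu.-integrable (box b) (EFin \o (fun x => evalx q x * rho k x)).
    have [M M0 qM] := evalx_bounded b q; apply: (int_bounded _ (M * (2 * N k))).
      by apply: measurable_funM => //; exact: measurable_funTS.
    move=> x xb; rewrite normrM ler_pM ?qM //.
    by have /andP[r0 rN] := rho_bd x; rewrite ger0_norm.
  rewrite (eq_integral (fun x : borelRn R n =>
      ((evalx q x * rho k x)%:E - (N k * evalx q x)%:E)%E)); last first.
    by move=> x _; rewrite tauE -EFinB; congr (_%:E); ring.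
  rewrite (integralB_EFin mb iqrho); last first.
    exact: (integrableZl mb (N k) (iq q)).
  under [X in (_ - X)%E]eq_integral do rewrite EFinM.
  rewrite integralZl //; last exact: iq.
  rewrite rhoL muL -EFinM -EFinB; congr (_%:E).
  by rewrite Vr_mulxDr linearD /= LxC; lra.
have LE p : (\int[mu]_(x in box b) (Vr_eval p x (tau x))%:E = (L p)%:E)%E.
  rewrite (eq_integral (fun x : borelRn R n => ((evalx p.1 x)%:E +
      \sum_k ((tau x : 'rV[R]_r) ord0 k * evalx (p.2 k) x)%:E)%E)); last first.
    by move=> x _; rewrite sumEFin -EFinD.
  rewrite integralD //=; [|exact: iq|by apply: integrable_sum => //].
  rewrite integral_sum // muL [in RHS](Vr_lambda_decomposition p) linearD EFinD.
  congr (_ + _)%E; rewrite linear_sum /= -sumEFin; apply: eq_bigr => k _.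
  exact: Llambda.
have mVr p (D : set (borelRn R n)) : measurable_fun D (fun x => Vr_eval p x (tau x)).
  by apply: measurable_Vr_eval => k; exact: mtau.
have sb : msupport mu `<=` box b by exact: msupport_sub_box.
have ms := measurable_msupport mu.
exists mu, tau; split.
- exact: msupport_compact muC.
- by apply: measurable_rV => // k; exact: mtau.
- exists S; split; first exact: num_real.
  move=> M SM _ [x _ <-]; apply: le_trans (ltW SM).
  exact: box_norm.
- have gi i : {ae mu, forall x, box b x -> 0 <= Vr_eval (g i) x (tau x)}.
    have [M gM] := Vr_eval_bounded (g i) S0 (fun x (_ : box b x) => tauS x).
    have neg0 : mu (box b `&` [set x | Vr_eval (g i) x (tau x) < 0]) = 0%E.
      apply: (density_ge0 b_gt0 muC muL _ gM); first exact: mVr.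
      move=> f f0; have Mgi : quad_module g (g i).
        exists 0, (fun j => if j == i then 1 else 0); split.
        - by exists [::]; rewrite big_nil.
        - move=> j; case: eqP => _; last by exists [::]; rewrite big_nil.
          by exists [:: 1]; rewrite big_seq1 expr1n.
        - rewrite (bigD1 i) //= eqxx Vr_mulx1 big1 ?addr0; last first.
            move=> j /negPf ->; rewrite /Vr_mulx mul0r; congr (_, _).
            by apply/ffunP => k; rewrite !ffunE mul0r.
          by rewrite -[LHS]add0r.
      rewrite (eq_integral (fun x : borelRn R n =>
          (Vr_eval (Vr_mulx f (g i)) x (tau x))%:E)); last first.
        by move=> x _; rewrite Vr_eval_mulx.
      by rewrite LE lee_fin; exact: (pos _ Mgi).2.
    exists (box b `&` [set x | Vr_eval (g i) x (tau x) < 0]); split=> //.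
      rewrite (_ : _ `&` _ = box b `&` ((fun x => Vr_eval (g i) x (tau x)) @^-1`
        ([set` Interval -oo%O (BLeft 0)]))); first exact: mVr.
      by apply/seteqP; split=> x /=; rewrite in_itv.
    move=> x /= nx; apply: contrapT => nneg; apply: nx => xb.
    by rewrite leNgt; apply/negP => Vneg; apply: nneg; split.
  apply: (filterS _ (filter_forall _ gi)) => x gx xs i.
  by apply: gx; exact: sb.
- move=> p; rewrite -LE (integral_msupport (D := box b)) //.
  by apply/measurable_EFinP; exact: mVr.
Qed.

End Existence.

(** * Uniqueness of the representation *)

Section Uniqueness.
Context {R : realType} {n r m : nat} (g : 'I_m -> Vr R n r).
Context (L : {scalar Vr R n r}).
Context (mu1 mu2 : probability (borelRn R n) R).
Context (tau1 tau2 : borelRn R n -> borelRn R r).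
Hypothesis rep1 : represents g L mu1 tau1.
Hypothesis rep2 : represents g L mu2 tau2.

Lemma represents_common_box : exists b : R,
  [/\ 0 < b, msupport mu1 `<=` box b & msupport mu2 `<=` box b].
Proof.
have [c1 _ _ _ _] := rep1; have [c2 _ _ _ _] := rep2.
have [b1 b10 sb1] := compact_sub_box c1; have [b2 b20 sb2] := compact_sub_box c2.
exists (Num.max b1 b2); split; first by rewrite lt_max b10.
  by apply: sb1; rewrite le_max lexx.
by apply: sb2; rewrite le_max lexx orbT.
Qed.

Lemma represents_measure_unique (A : set (borelRn R n)) :
  measurable A -> mu1 A = mu2 A.
Proof.
move=> mA; have [b [b0 sb1 sb2]] := represents_common_box.
have [C1 L1] := represents_box rep1 sb1.
have [C2 L2] := represents_box rep2 sb2.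
by rewrite (moments_daniell_measure b0 C1 L1) // (moments_daniell_measure b0 C2 L2).
Qed.

Lemma represents_density_unique (k : 'I_r) :
  {ae mu1, forall x, msupport mu1 x ->
     (tau1 x : 'rV[R]_r) ord0 k = (tau2 x : 'rV[R]_r) ord0 k}.
Proof.
have [b [b0 sb1 sb2]] := represents_common_box.
have [C1 L1] := represents_box rep1 sb1.
have mb := measurable_box (n := n) b.
(* The support depends only on the measure of open sets, so both maps can be compared on one set. *)
have suppE : msupport mu2 = msupport mu1.
  apply/seteqP; split=> x xs U oU Ux.
    by rewrite represents_measure_unique ?xs //; exact: open_borel_measurable.
  by rewrite -represents_measure_unique ?xs //; exact: open_borel_measurable.
have ms := measurable_msupport mu1.
have [_ mt1 [M1 [_ tM1]] _ LE1] := rep1.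
have [_ mt2 [M2 [_ tM2]] _ LE2] := rep2.
rewrite suppE in mt2 tM2 LE2.
(* Vanishing moments meet the hypothesis of [density_ge0] for D and for -D; below, D is the
   difference of two components in either order. As D is controlled on the support only, it is
   extended by 0 to the box. *)
have key (D : borelRn R n -> R) M : measurable_fun (msupport mu1) D ->
    (forall x, msupport mu1 x -> `|D x| <= M) ->
    (forall q, (\int[mu1]_(x in msupport mu1) (evalx q x * D x)%:E = 0)%E) ->
    {ae mu1, forall x, msupport mu1 x -> 0 <= D x}.
  move=> mD DM qD; pose D' := D \_ (msupport mu1).
  have D'E x : msupport mu1 x -> D' x = D x.
    by move=> xs; rewrite /D' patchE mem_set.
  have mD' : measurable_fun setT D' by apply/(measurable_restrictT _ ms).
  have M0 : 0 <= Num.max M 0 by rewrite le_max lexx orbT.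
  have D'M x : box b x -> `|D' x| <= Num.max M 0.
    move=> _; rewrite /D' patchE; case: ifPn => [/set_mem xs|_]; last first.
      by rewrite normr0.
    by rewrite le_max DM.
  have neg0 : mu1 (box b `&` [set x | D' x < 0]) = 0%E.
    apply: (density_ge0 b0 C1 L1 _ D'M); first exact: measurable_funTS.
    move=> f _; rewrite -(integral_msupport (D := box b)) //.
      rewrite (eq_integral (fun x : borelRn R n => (evalx f x * D x)%:E)) ?qD //.
      by move=> x /set_mem xs; rewrite D'E.
    apply/measurable_EFinP; apply: measurable_funM; apply: measurable_funTS => //.
    exact: measurable_evalx.
  exists (box b `&` [set x | D' x < 0]); split=> //.
    apply: measurableI => //.
    rewrite (_ : [set x | _] = setT `&` (D' @^-1`
      ([set` Interval -oo%O (BLeft 0)]))); first exact: mD'.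
    by apply/seteqP; split=> x /=; rewrite in_itv //= => -[].
  move=> x /= nx; apply: contrapT => nneg; apply: nx => xs.
  rewrite leNgt; apply/negP => Dneg; apply: nneg; split; first exact: sb1.
  by rewrite /= D'E.
pose t1 x := (tau1 x : 'rV[R]_r) ord0 k; pose t2 x := (tau2 x : 'rV[R]_r) ord0 k.
have mt1k : measurable_fun (msupport mu1) t1 by exact: measurable_coord.
have mt2k : measurable_fun (msupport mu1) t2 by exact: measurable_coord.
have t1M x : msupport mu1 x -> `|t1 x| <= `|M1| + 1.
  move=> xs; apply: le_trans (norm_coord_le _ _) _.
  by apply: (tM1 (`|M1| + 1)); [rewrite ltr_pwDr // ler_norm|exists x].
have t2M x : msupport mu1 x -> `|t2 x| <= `|M2| + 1.
  move=> xs; apply: le_trans (norm_coord_le _ _) _.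
  by apply: (tM2 (`|M2| + 1)); [rewrite ltr_pwDr // ler_norm|exists x].
have mufin : (mu1 (msupport mu1) < +oo)%E by rewrite ltey_eq fin_num_measure.
have mq q : measurable_fun (msupport mu1) (evalx q : borelRn R n -> R).
  by apply: measurable_funTS; exact: measurable_evalx.
have int_q (t : borelRn R n -> R) M q : measurable_fun (msupport mu1) t ->
    (forall x, msupport mu1 x -> `|t x| <= M) ->
    mu1.-integrable (msupport mu1) (EFin \o (fun x => evalx q x * t x)).
  move=> mt tM; have [N N0 qN] := evalx_bounded b q.
  apply: (bounded_integrable (M := N * M)) => //; first exact: measurable_funM.
  by move=> x xs; rewrite normrM ler_pM ?tM // qN //; exact: sb1.
have Eq1 q : (\int[mu1]_(x in msupport mu1) (evalx q x * t1 x)%:E =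
    (L (Vr_mulx q (Vr_lambda k)))%:E)%E.
  by rewrite LE1; apply: eq_integral => x _; rewrite Vr_eval_mulx Vr_eval_lambda.
have Eq2 q : (\int[mu1]_(x in msupport mu1) (evalx q x * t2 x)%:E =
    (L (Vr_mulx q (Vr_lambda k)))%:E)%E.
  rewrite LE2 (eq_measure_integral mu2) => [|A mA _]; last first.
    exact: represents_measure_unique.
  by apply: eq_integral => x _; rewrite Vr_eval_mulx Vr_eval_lambda.
have diff0 (s1 s2 : borelRn R n -> R) N1 N2 :
    measurable_fun (msupport mu1) s1 -> measurable_fun (msupport mu1) s2 ->
    (forall x, msupport mu1 x -> `|s1 x| <= N1) ->
    (forall x, msupport mu1 x -> `|s2 x| <= N2) ->
    (forall q, \int[mu1]_(x in msupport mu1) (evalx q x * s1 x)%:E =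
       \int[mu1]_(x in msupport mu1) (evalx q x * s2 x)%:E)%E ->
    {ae mu1, forall x, msupport mu1 x -> s2 x <= s1 x}.
  move=> ms1 ms2 s1N s2N s12.
  have : {ae mu1, forall x, msupport mu1 x -> 0 <= s1 x - s2 x}.
    apply: (key _ (N1 + N2)); first exact: measurable_funB.
      by move=> x xs; rewrite (le_trans (ler_normB _ _)) // lerD ?s1N ?s2N.
    move=> q; rewrite (eq_integral (fun x : borelRn R n =>
        ((evalx q x * s1 x)%:E - (evalx q x * s2 x)%:E)%E)); last first.
      by move=> x _; rewrite mulrBr EFinB.
    rewrite (integralB_EFin ms (int_q _ _ _ ms1 s1N) (int_q _ _ _ ms2 s2N)).
    rewrite s12 subee //.
    by apply: integrable_fin_num => //; exact: int_q s2N.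
  by apply: filterS => x s21 xs; rewrite -subr_ge0; exact: s21.
have Eq12 q := etrans (Eq1 q) (esym (Eq2 q)).
have le21 := diff0 _ _ _ _ mt1k mt2k t1M t2M Eq12.
have le12 := diff0 _ _ _ _ mt2k mt1k t2M t1M (fun q => esym (Eq12 q)).
apply: filterS2 le21 le12 => x h21 h12 xs.
by apply/eqP; rewrite eq_le h12 // h21.
Qed.

End Uniqueness.

Theorem lemma3p6 (R : realType) (n r m : nat) (g : 'I_m -> Vr R n r)
    (g_arch : restricted_archimedean g) (L : {scalar Vr R n r}) :
  ((L (Vr_of_polyx 1) = 1 /\ (forall p, quad_module g p -> 0 <= L p)) <->
   (exists (mu : probability (borelRn R n) R)
           (tau : borelRn R n -> borelRn R r), represents g L mu tau)) /\
  (forall (mu1 mu2 : probability (borelRn R n) R)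
          (tau1 tau2 : borelRn R n -> borelRn R r),
    represents g L mu1 tau1 -> represents g L mu2 tau2 ->
    (forall A : set (borelRn R n), measurable A -> mu1 A = mu2 A) /\
    (forall k : 'I_r, {ae mu1, forall x, msupport mu1 x ->
       (tau1 x : 'rV[R]_r) ord0 k = (tau2 x : 'rV[R]_r) ord0 k})).
Proof.
split; first split.
- by move=> [L1 L_ge0]; exact: positive_represented.
- by move=> [mu [tau rep]]; exact: represents_positive rep.
- move=> mu1 mu2 tau1 tau2 rep1 rep2; split.
    exact: represents_measure_unique rep1 rep2.
  exact: represents_density_unique rep1 rep2.
Qed.
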